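(* Let $M=M(P,\Lambda)$ be the quasitoric manifold determined by combinatorial data $(P,\Lambda)$, with moment map $\pi\colon M\to P\subset\mathbb R^n$. Let $w_1,\dots,w_q\in\mathbb Z^n$ be the pairwise distinct edge vectors $w_r$ ($r$ an edge of $P$) and let $\Phi\colon\mathbb T^n\to\mathbb T^q$, $\Phi(t)=(t^{w_1},\dots,t^{w_q})$, be the corresponding representation. Then the moment map $\pi$ can be extended to a real-algebraic embedding $$\pi\times\tilde\varphi\colon M\to\mathbb R^n\times\mathbb C^q$$ equivariant with respect to $\Phi$; here $\tilde\varphi\colon M\to\mathbb C^q$ is a monomial map, $\mathbb T^q$ acts trivially on $\mathbb R^n$ and in the standard coordinatewise way on $\mathbb C^q$.
   Context: Tori. $\mathbb T^k=\{t\in\mathbb C^k:|t_j|=1\}$. For $a\in\mathbb Z^k$, $t\in\mathbb T^k$ put $t^a=\prod_j t_j^{a_j}$; an integral $(p\times k)$-matrix $A$ with rows $A_1,\dots,A_p$ defines the homomorphism $\mathbb T^k\to\mathbb T^p$, $t\mapsto t^A=(t^{A_1},\dots,t^{A_p})$. Polytope and moment-angle manifold. $P=\{x\in\mathbb R^n: A_Px+b_P\ge 0\}$ is a simple (bounded, $n$-dimensional) polytope given by $m$ irredundant inequalities, $A_P$ an $(m\times n)$-matrix, $b_P\in\mathbb R^m$; $F_1,\dots,F_m$ are the facets (in the order of the inequalities), and $F_I=\bigcap_{i\in I}F_i$ for $I\subset[1,m]$; each face is written $F_I$ with $I$ the set of all facets containing it. $i_P(x)=A_Px+b_P$, $\rho(z_1,\dots,z_m)=(|z_1|^2,\dots,|z_m|^2)$,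 and $\mathcal Z_P=\rho^{-1}(i_P(P))\subset\mathbb C^m$ is the moment-angle manifold, a smooth $\mathbb T^m$-invariant submanifold of dimension $m+n$. $\rho_P\colon\mathcal Z_P\to P$ is the map with $i_P\circ\rho_P=\rho$. Quasitoric manifold. $\Lambda$ is an integral $(n\times m)$-matrix satisfying the independence condition: for every vertex $v$ of $P$ the $(n\times n)$-submatrix formed by the columns of the facets containing $v$ has determinant $\pm1$. Let $l\colon\mathbb T^m\to\mathbb T^n$, $l(t)=t^\Lambda$, and $K=\ker l$, an $(m-n)$-dimensional torus acting freely on $\mathcal Z_P$. $M=\mathcal Z_P/K$ is the quasitoric manifold, with the action of $\mathbb T^n\cong\mathbb T^m/K$; $\pi_l\colon\mathcal Z_P\to M$ is the quotient map and $\pi\colon M\to P$ (moment map) is defined by $\rho_P=\pi\circ\pi_l$. Edge vectors. For an edge $r=F_J$ of $P$, $w_r\in\mathbb Z^n$ is the primitive vector orthogonal to all columns of $\Lambda$ with indices in $J$, with sign chosen so that the first nonzero coordinate of $\Lambda^Tw_r\in\mathbb Z^m$ is positive. (Equivalently, $t\mapsto t^{w_r}$ is a character of $\mathbb T^n$ whose kernel is the isotropy subgroup of $\pi^{-1}(r)$.) The number $q$ of distinct vectors does not exceed the number of edges of $P$. Monomial maps. For $a\in\mathbb Z^m$ let $\varphi_a(z)=\prod_i\hat z_i^{a_i}$ where $\hat z_i^{a_i}=z_i^{a_i}$ if $a_i>0$, $=\bar z_i^{-a_i}$ if $a_i<0$, $=1$ if $a_i=0$. If $a_1,\dots,a_q\in\mathbb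 Z^m$ all define the trivial character of $K$ (i.e. $t^{a_j}=1$ for $t\in K$), then $(\varphi_{a_1},\dots,\varphi_{a_q})|_{\mathcal Z_P}$ is $K$-invariant and descends to a smooth map $\tilde\varphi\colon M\to\mathbb C^q$, called a monomial map. ''Real-algebraic'' means that the composition with $\pi_l\colon\mathcal Z_P\to M$ is the restriction to $\mathcal Z_P\subset\mathbb C^m$ of a real-polynomial map; ''embedding'' means smooth embedding. *)

(* Defs.v *)
From HB Require Import structures.
From mathcomp Require Import all_boot all_order all_algebra.
From mathcomp Require Import all_classical all_reals all_analysis.
From mathcomp Require Import complex generic_quotient.
From mathcomp Require mpoly.

Set Implicit Arguments.
Unset Strict Implicit.
Unset Printing Implicit Defensive.

Import Order.TTheory GRing.Theory Num.Theory.
Import numFieldNormedType.Exports.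

Local Open Scope classical_set_scope.
Local Open Scope quotient_scope.
Local Open Scope ring_scope.

(* C^k is 'rV[R]_(k + k), real parts first and imaginary parts second, so that
   it carries the library's structure of real normed space; [coordC] and [ofC]
   translate from and to complex coordinates. *)
Section ComplexCoordinates.
Context {R : realType} {k : nat}.

Definition coordC (z : 'rV[R]_(k + k)) (j : 'I_k) : R[i] :=
  (z 0 (lshift k j) +i* z 0 (rshift k j))%C.

Definition ofC (f : 'I_k -> R[i]) : 'rV[R]_(k + k) :=
  row_mx (\row_j complex.Re (f j)) (\row_j complex.Im (f j)).

Lemma ofCK f j : coordC (ofC f) j = f j.
Proof. by rewrite /coordC row_mxEl row_mxEr !mxE; case: (f j). Qed.

Lemma coordCK z : ofC (coordC z) = z.
Proof.
by apply/rowP => j; case: (split_ordP j) => i ->; rewrite ?row_mxEl ?row_mxEr mxE.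
Qed.

End ComplexCoordinates.

Section Torus.
Context {R : realType}.

Definition torus k : set 'rV[R[i]]_k := [set t | forall j, `|t 0 j| = 1].

Definition character k (t : 'rV[R[i]]_k) (a : 'rV[int]_k) : R[i] :=
  \prod_j t 0 j ^ a 0 j.

Definition torus_hom p k (A : 'M[int]_(p, k)) (t : 'rV[R[i]]_k) :
  'rV[R[i]]_p := \row_i character t (row i A).

Definition torus_act k (t : 'rV[R[i]]_k) (z : 'rV[R]_(k + k)) :
  'rV[R]_(k + k) := ofC (fun j => t 0 j * coordC z j).

Definition torus_ker p k (A : 'M[int]_(p, k)) : set 'rV[R[i]]_k :=
  [set t | torus t /\ torus_hom A t = const_mx 1].

End Torus.

Section Polytope.
Context {R : realType} {n m : nat}.
Implicit Types (A : 'M[R]_(m, n)) (b : 'cV[R]_m).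

Definition polyhedron A b : set 'cV[R]_n :=
  [set x | forall i, 0 <= (A *m x + b) i 0].

Definition face A b (I : {set 'I_m}) : set 'cV[R]_n :=
  [set x | polyhedron A b x /\ forall i, i \in I -> (A *m x + b) i 0 = 0].

(* The affine hull of S has dimension d. *)
Definition has_dim (S : set 'cV[R]_n) (d : nat) :=
  exists x (V : 'M[R]_(n, d)),
    [/\ \rank V = d, S x, forall j, S (x + col j V) &
        forall y, S y -> exists c : 'cV[R]_d, y = x + V *m c].

(* F_I is a d-dimensional face and I consists of all the facets containing
   it. *)
Definition is_face A b (d : nat) (I : {set 'I_m}) :=
  has_dim (face A b I) d /\
  forall i, face A b I `<=` face A b [set i]%SET -> i \in I.

Definition vertex A b := is_face A b 0.
Definition edge A b := is_face A b 1.

Definition irredundant A b :=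
  forall i, exists2 x : 'cV[R]_n,
    (A *m x + b) i 0 < 0 & forall j, j != i -> 0 <= (A *m x + b) j 0.

Definition simple_polytope A b :=
  [/\ bounded_set (polyhedron A b), has_dim (polyhedron A b) n,
      irredundant A b & forall I, vertex A b I -> #|I| = n].

(* A vertex of a simple polytope lies on n facets; an enumeration f of them
   only matters up to order, which affects the sign of the minor. *)
Definition independence A b (Lam : 'M[int]_(n, m)) :=
  forall (I : {set 'I_m}) (f : 'I_n -> 'I_m),
    vertex A b I -> injective f -> (forall i, i \in I <-> exists k, f k = i) ->
    \det (colsub f Lam) = 1 \/ \det (colsub f Lam) = -1.

End Polytope.

Section EdgeVectors.
Context {R : realType} {n m : nat}.

Definition primitive (w : 'rV[int]_n) := \big[gcdn/0%N]_i absz (w 0 i) = 1%N.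

Definition is_edge_vector (Lam : 'M[int]_(n, m)) (J : {set 'I_m})
    (w : 'rV[int]_n) :=
  [/\ primitive w,
      forall j, j \in J -> (w *m Lam) 0 j = 0 &
      exists2 j, 0 < (w *m Lam) 0 j &
        forall i : 'I_m, (i < j)%N -> (w *m Lam) 0 i = 0].

Definition edge_vectors (A : 'M[R]_(m, n)) (b : 'cV[R]_m)
    (Lam : 'M[int]_(n, m)) : set 'rV[int]_n :=
  [set w | exists2 J, edge A b J & is_edge_vector Lam J w].

End EdgeVectors.

Section MomentAngle.
Context {R : realType} {n m : nat}.
Variables (A : 'M[R]_(m, n)) (b : 'cV[R]_m).

Definition rho (z : 'rV[R]_(m + m)) : 'cV[R]_m :=
  \col_j (z 0 (lshift m j) ^+ 2 + z 0 (rshift m j) ^+ 2).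

Definition moment_angle_set : set 'rV[R]_(m + m) :=
  [set z | exists2 x, polyhedron A b x & A *m x + b = rho z].

Definition moment_angle : Type := set_type moment_angle_set.

Definition rho_P (z : moment_angle) : 'cV[R]_n :=
  xget 0 [set x | polyhedron A b x /\ A *m x + b = rho (val z)].

Lemma rho_P_spec z :
  polyhedron A b (rho_P z) /\ A *m rho_P z + b = rho (val z).
Proof.
have [x Px xz] : moment_angle_set (val z) by exact/set_mem/(valP z).
by rewrite /rho_P; case: xgetP => [y _ //|/(_ x)]; case.
Qed.

End MomentAngle.

Section Quasitoric.
Context {R : realType} {n m : nat}.
Variables (A : 'M[R]_(m, n)) (b : 'cV[R]_m) (Lam : 'M[int]_(n, m)).

Definition same_orbit (z z' : moment_angle A b) : bool :=
  `[< exists2 t, torus_ker Lam t & val z' = torus_act t (val z) >].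

Lemma same_orbit_equiv : equiv_class_of same_orbit.
Proof.
have act_mul t t' (z : 'rV[R]_(m + m)) :
    torus_act t (torus_act t' z) = torus_act (\row_j (t 0 j * t' 0 j)) z.
  by congr ofC; apply/funext => j; rewrite ofCK mxE mulrA.
have act1 (z : 'rV[R]_(m + m)) : torus_act (const_mx 1) z = z.
  rewrite -[RHS]coordCK; congr ofC; apply/funext => j.
  by rewrite mxE mul1r.
have ker1 : torus_ker Lam (const_mx 1 : 'rV[R[i]]_m).
  split=> [j|]; first by rewrite mxE normr1.
  apply/rowP => i; rewrite !mxE /character big1// => j _.
  by rewrite !mxE exp1rz.
have kerM (t t' : 'rV[R[i]]_m) : torus_ker Lam t -> torus_ker Lam t' ->
    torus_ker Lam (\row_j (t 0 j * t' 0 j)).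
  move=> [t1 tL] [t'1 t'L]; split=> [j|].
    by rewrite mxE normrM t1 t'1 mulr1.
  apply/rowP => i; move/rowP/(_ i): tL; move/rowP/(_ i): t'L.
  rewrite !mxE => t'L tL; transitivity (1 * 1 : R[i]); last by rewrite mulr1.
  rewrite -[in X in X * _]tL -t'L /character -big_split.
  apply: eq_bigr => j _ /=.
  by rewrite !mxE exprzMl// unitfE -normr_eq0 ?t1 ?t'1 oner_eq0.
have kerV (t : 'rV[R[i]]_m) : torus_ker Lam t ->
    torus_ker Lam (\row_j (t 0 j)^-1).
  move=> [t1 tL]; split=> [j|]; first by rewrite mxE normfV t1 invr1.
  apply/rowP => i; move/rowP/(_ i): tL; rewrite !mxE => tL.
  rewrite -[RHS]invr1 -tL /character -prodfV; apply: eq_bigr => j _.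
  by rewrite !mxE exprz_inv -invr_expz.
split=> [z|z z'|z2 z1 z3].
- by apply/asboolP; exists (const_mx 1).
- have sym y y' : same_orbit y y' -> same_orbit y' y.
    move=> /asboolP[t Kt yt]; apply/asboolP; exists (\row_j (t 0 j)^-1).
      exact: kerV.
    rewrite yt act_mul -[LHS]act1; congr torus_act.
    apply/rowP => j; rewrite !mxE mulVf// -normr_eq0.
    by case: Kt => -> _; rewrite oner_eq0.
  by apply/idP/idP; exact: sym.
- move=> /asboolP[t Kt yt] /asboolP[t' Kt' yt']; apply/asboolP.
  by exists (\row_j (t' 0 j * t 0 j)); [exact: kerM|rewrite yt' yt act_mul].
Qed.

Canonical orbit_equiv := EquivRelPack same_orbit_equiv.

Definition quasitoric : Type := quotient_topology {eq_quot orbit_equiv}.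

Definition pi_l (z : moment_angle A b) : quasitoric := \pi_quasitoric%qT z.

Definition moment_map (p : quasitoric) : 'cV[R]_n := rho_P (repr p).

(* T^n acts on M through T^n = T^m / K : t sends [z] to [s z] for any s with
   s^Lam = t. *)
Definition quasitoric_act (t : 'rV[R[i]]_n) (p : quasitoric) : quasitoric :=
  xget p [set p' | exists (s : 'rV[R[i]]_m) z z',
    [/\ torus s, torus_hom Lam s = t, pi_l z = p,
        val z' = torus_act s (val z) & pi_l z' = p']].

End Quasitoric.

Section MonomialMaps.
Context {R : realType}.

Definition hat_pow (z : R[i]) (a : int) : R[i] :=
  match a with Posz k => z ^+ k | Negz k => (z^*)%C ^+ k.+1 end.

Definition monomial m (a : 'rV[int]_m) (z : 'rV[R]_(m + m)) : R[i] :=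
  \prod_i hat_pow (coordC z i) (a 0 i).

Definition monomial_map n m (A : 'M[R]_(m, n)) (b : 'cV[R]_m)
    (Lam : 'M[int]_(n, m)) q (phi : quasitoric A b Lam -> 'rV[R]_(q + q)) :=
  exists2 a : 'I_q -> 'rV[int]_m,
    forall j (t : 'rV[R[i]]_m), torus_ker Lam t -> character t (a j) = 1 &
    forall z, phi (pi_l Lam z) = ofC (fun j => monomial (a j) (val z)).

Definition real_polynomial d p q (g : 'rV[R]_d -> 'M[R]_(p, q)) :=
  exists P : 'I_p -> 'I_q -> mpoly.mpoly d R,
    forall z i j, g z i j = mpoly.meval (fun k => z 0 k) (P i j).

Definition real_algebraic n m (A : 'M[R]_(m, n)) (b : 'cV[R]_m)
    (Lam : 'M[int]_(n, m)) k q
    (f : quasitoric A b Lam -> 'cV[R]_k * 'rV[R]_(q + q)) :=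
  exists g h, [/\ real_polynomial g, real_polynomial h &
    forall z, f (pi_l Lam z) = (g (val z), h (val z))].

End MonomialMaps.

Section Smoothness.
Context {R : realType}.

Fixpoint Ck_on (V W : normedModType R) (k : nat) (U : set V) (f : V -> W) :=
  match k with
  | 0 => forall x, U x -> {for x, continuous f}
  | k'.+1 => (forall x, U x -> differentiable f x) /\
             forall v, Ck_on k' U (fun x => 'D_v f x)
  end.

Definition smooth_on (V W : normedModType R) (U : set V) (f : V -> W) :=
  forall k, Ck_on k U f.

Context {n m : nat}.
Variables (A : 'M[R]_(m, n)) (b : 'cV[R]_m) (Lam : 'M[int]_(n, m)).
Local Notation M := (quasitoric A b Lam).

(* The smooth structure of M is the one for which pi_l is a submersion from the
   submanifold Z_P of C^m. Its charts are the parametrizations phi of open sets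
   of M by open sets U of R^(2n) such that phi is smooth, that is, lifts
   locally to smooth maps into Z_P, and phi^-1 is smooth, that is,
   phi^-1 \o pi_l is locally the restriction of a smooth map on C^m. *)
Definition smooth_chart (U : set 'rV[R]_(n + n)) (phi : 'rV[R]_(n + n) -> M) :=
  [/\ open U, open (phi @` U),
      forall u v, U u -> U v -> phi u = phi v -> u = v,
      forall u, U u -> exists (U' : set 'rV[R]_(n + n))
          (s : 'rV[R]_(n + n) -> 'rV[R]_(m + m)),
        [/\ open U', U' u, smooth_on U' s &
            forall u', U' u' ->
              exists2 z, val z = s u' & pi_l Lam z = phi u'] &
      forall z, (phi @` U) (pi_l Lam z) -> exists (O : set 'rV[R]_(m + m))
          (g : 'rV[R]_(m + m) -> 'rV[R]_(n + n)),
        [/\ open O, O (val z), smooth_on O g &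
            forall z', O (val z') ->
              U (g (val z')) /\ phi (g (val z')) = pi_l Lam z']].

Definition smooth_immersion (W : normedModType R) (f : M -> W) :=
  forall p, exists U phi u,
    [/\ smooth_chart U phi, U u, phi u = p,
        smooth_on U (f \o phi) & injective ('d (f \o phi) u)].

Definition topological_embedding (X Y : topologicalType) (f : X -> Y) :=
  [/\ injective f, continuous f &
      forall O, open O -> exists2 O', open O' & f @` O = range f `&` O'].

Definition smooth_embedding (W : normedModType R) (f : M -> W) :=
  smooth_immersion f /\ topological_embedding f.

End Smoothness.

Section Equivariance.
Context {R : realType} {n m q : nat}.
Variables (A : 'M[R]_(m, n)) (b : 'cV[R]_m) (Lam : 'M[int]_(n, m)).

Definition target_act k (s : 'rV[R[i]]_q) (y : 'cV[R]_k * 'rV[R]_(q + q)) :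
  'cV[R]_k * 'rV[R]_(q + q) := (y.1, torus_act s y.2).

Definition equivariant k (Phi : 'rV[R[i]]_n -> 'rV[R[i]]_q)
    (f : quasitoric A b Lam -> 'cV[R]_k * 'rV[R]_(q + q)) :=
  forall t p, torus t -> f (quasitoric_act t p) = target_act (Phi t) (f p).

End Equivariance.

Section MomentMapLemma.
Context {R : realType} {n m : nat}.
Variables (A : 'M[R]_(m, n)) (b : 'cV[R]_m) (Lam : 'M[int]_(n, m)).

Lemma moment_mapE (z : moment_angle A b) : moment_map (pi_l Lam z) = rho_P z.
Proof.
have rho_act (t : 'rV[R[i]]_m) (y : 'rV[R]_(m + m)) :
    torus t -> rho (torus_act t y) = rho y.
  move=> t1; apply/colP => j; rewrite [LHS]mxE [RHS]mxE.
  have normE (u : 'rV[R]_(m + m)) : `|coordC u j| ^+ 2 =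
      ((u 0 (lshift m j) ^+ 2 + u 0 (rshift m j) ^+ 2)%:C)%C.
    by rewrite normc_def -rmorphXn /= sqr_sqrtr// addr_ge0// sqr_ge0.
  apply: (@complexI R); rewrite -(normE (torus_act t y)) -(normE y).
  by rewrite ofCK normrM t1 mul1r.
have /eqmodP/asboolP[t [t1 _] zE] :
    repr (pi_l Lam z) = z %[mod {eq_quot orbit_equiv A b Lam}].
  exact: (@reprK _ (quasitoric A b Lam)).
by rewrite /moment_map /rho_P zE rho_act.
Qed.
End MomentMapLemma.

(* Main.v *)
(* At a vertex of P the rows of A indexed by the n facets I through it and, over
   the integers, the columns of Lambda indexed by I form invertible matrices.
   So a point of M whose moment-map image avoids the facets outside I has a
   unique representative in Z_P whose coordinates outside I are positive, and
   its coordinates in I are a chart with values in C^n. Dropping i from I gives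
   an edge whose vector pairs with the columns of I as +-e_i; in the chart, its
   monomial is the i-th coordinate or its conjugate times a positive function of
   the moment map. Dividing by that function gives a smooth left inverse of the
   embedding, defined on an open subset of R^n x C^q, which yields at once
   injectivity, injectivity of the differential and openness onto the image. *)

Require Import Defs.
From HB Require Import structures.
From mathcomp Require Import all_boot all_order all_algebra.
From mathcomp Require Import all_classical all_reals all_analysis.
From mathcomp Require Import complex generic_quotient.
From mathcomp Require mpoly.

Set Implicit Arguments.
Unset Strict Implicit.
Unset Printing Implicit Defensive.

Import Order.TTheory GRing.Theory Num.Theory.
Import numFieldNormedType.Exports.
Local Open Scope classical_set_scope.
Local Open Scope quotient_scope.
Local Open Scope ring_scope.

(** * Smooth maps and algebras of functions *)

Section NearEq.
Context {R : realType} {V W : normedModType R}.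

(** The first-order expansion of [f] at [x] is also one of [g], and uniqueness of the differential
    then identifies the two differentials. *)
Lemma near_eq_differentiable (f g : V -> W) (x : V) :
  {near x, f =1 g} -> differentiable f x -> differentiable g x.
Proof.
move=> fg /diff_locallyP[df_cont dfE].
have gE : g \o shift x = cst (g x) + 'd f x +o_ 0 id.
  apply/eqaddoP => e e0; move/eqaddoP : dfE => /(_ e e0).
  have fgx : f x = g x := nbhs_singleton fg.
  move: fg; rewrite (near_shift 0 x) => fg; apply: filterS2 fg => h /=.
  by rewrite !fctE /= subr0 fgx => ->.
by apply/diff_locallyP; rewrite (diff_unique df_cont gE).
Qed.

(** Openness of [U] turns equality on [U] into equality near each of its points, which
    differentiation sees. The closure lemmas below rely on this: their formulas for derivatives are
    valid on [U] only. *)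
Lemma Ck_on_eq k (U : set V) (f g : V -> W) :
  open U -> {in U, f =1 g} -> Ck_on k U f -> Ck_on k U g.
Proof.
move=> oU; elim: k f g => [|k IH] f g fg /=;
  have nfg x : U x -> {near x, f =1 g} by
    move=> Ux; apply: filterS (open_nbhs_nbhs (conj oU Ux)) => y Uy;
    apply: fg; rewrite inE.
  move=> cf x Ux; rewrite /prop_for /continuous_at -fg ?inE//.
  exact: cvg_trans (near_eq_cvg (nfg x Ux)) (cf x Ux).
move=> [df cf]; split=> [x Ux|v].
  exact: near_eq_differentiable (nfg x Ux) (df x Ux).
by apply: IH (cf v) => x /set_mem Ux; exact: near_eq_derive (nfg x Ux).
Qed.

Lemma Ck_on_le k (U : set V) (f : V -> W) : Ck_on k.+1 U f -> Ck_on k U f.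
Proof.
elim: k f => [f [df _] x Ux|k IH f [df cf]]; last by split=> // v; exact/IH/cf.
exact/differentiable_continuous/df.
Qed.

Lemma Ck_on_cst k (U : set V) (c : W) : Ck_on k U (cst c).
Proof.
elim: k c => [|k IH] c /=; first by move=> x _; exact: cst_continuous.
split=> [x _|v]; first exact: differentiable_cst.
by rewrite (_ : (fun x => _) = cst 0)//; apply/funext => x; rewrite derive_cst.
Qed.

Lemma Ck_on_linear k (U : set V) (f : V -> W) :
  linear f -> continuous f -> Ck_on k U f.
Proof.
move=> lin_f; pose fm := GRing.isLinear.Build _ _ _ _ f lin_f.
pose fL : {linear V -> W} := HB.pack f fm.
rewrite (_ : f = fL)// => cf; case: k => [|k]; first by move=> x _; exact: cf.
have df x : differentiable fL x by exact: linear_differentiable.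
split=> // v; rewrite (_ : (fun x => _) = cst (fL v)); first exact: Ck_on_cst.
by apply/funext => x; rewrite deriveE// diff_lin.
Qed.

Lemma Ck_onD k (U : set V) (f g : V -> W) : open U ->
  Ck_on k U f -> Ck_on k U g -> Ck_on k U (f \+ g).
Proof.
move=> oU; elim: k f g => [|k IH] f g /= => [cf cg x Ux|[df cf] [dg cg]].
  by apply: continuousD; [exact: cf|exact: cg].
split=> [x Ux|v]; first by apply: differentiableD; [exact: df|exact: dg].
apply: Ck_on_eq (IH _ _ (cf v) (cg v)) => // x /set_mem Ux /=.
by rewrite deriveD//; apply: diff_derivable; [exact: df|exact: dg].
Qed.

Lemma Ck_onZl k (U : set V) (f : V -> R) (w : W) : open U ->
  Ck_on k U f -> Ck_on k U (fun x => f x *: w).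
Proof.
move=> oU; elim: k f => [|k IH] f /= => [cf x Ux|[df cf]].
  by apply: continuousZl; exact: cf.
split=> [x Ux|v]; first exact/differentiableZl/df.
apply: Ck_on_eq (IH _ (cf v)) => // x /set_mem Ux.
have dfx := df x Ux; rewrite !deriveE//; last exact: differentiableZl.
by rewrite diffZl.
Qed.

End NearEq.

Section SmoothFunctions.
Context {R : realType} {V : normedModType R}.
Implicit Types (U : set V) (f g : V -> R).

(** In the Leibniz rule the undifferentiated factor is needed at order [k] only, so [Ck_on_le]
    lowers it and the induction closes. *)
Lemma Ck_onM k U f g : open U ->
  Ck_on k U f -> Ck_on k U g -> Ck_on k U (f \* g).
Proof.
move=> oU; elim: k f g => [|k IH] f g => [cf cg x Ux|Cf Cg].
  by apply: continuousM; [exact: cf|exact: cg].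
have [[df cf] [dg cg]] := (Cf, Cg).
split=> [x Ux|v]; first by apply: differentiableM; [exact: df|exact: dg].
have := Ck_onD oU (IH _ _ (Ck_on_le Cf) (cg v)) (IH _ _ (Ck_on_le Cg) (cf v)).
apply: Ck_on_eq => // x /set_mem Ux /=.
by rewrite deriveM//; apply: diff_derivable; [exact: df|exact: dg].
Qed.

(** The derivative is [- f' * f^-1 * f^-1], where the induction hypothesis covers [f^-1] one order
    lower. *)
Lemma Ck_onV k U f : open U -> (forall x, U x -> f x != 0) ->
  Ck_on k U f -> Ck_on k U (fun x => (f x)^-1).
Proof.
move=> oU f0; elim: k => [|k IH] Cf.
  by move=> x Ux; apply: continuousV; [exact: f0|exact: Cf].
have [df cf] := Cf; split=> [x Ux|v].
  by apply: differentiableV; [exact: df|exact: f0].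
have CV := IH (Ck_on_le Cf).
have CN := @Ck_on_cst _ _ R k U (-1).
have := Ck_onM oU (Ck_onM oU CN (cf v)) (Ck_onM oU CV CV).
apply: Ck_on_eq => // x /set_mem Ux /=.
rewrite deriveV ?f0//; last exact/diff_derivable/df.
by rewrite scaleNr expr2 invfM mulN1r mulNr mulrC.
Qed.

Lemma differentiable_sqrt_comp f x : 0 < f x -> differentiable f x ->
  differentiable (Num.sqrt \o f) x /\
  forall v, 'D_v (Num.sqrt \o f) x = (2 * Num.sqrt (f x))^-1 * 'D_v f x.
Proof.
move=> fx0 df; have sqrt_fx : derivable (Num.sqrt : R -> R) (f x) 1.
  by have h := is_derive1_sqrt fx0; have := @ex_derive _ _ _ _ _ _ _ h.
have dsqrt : differentiable (Num.sqrt : R -> R) (f x).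
  by apply/derivable1_diffP; exact: sqrt_fx.
split=> [|v]; first exact: differentiable_comp.
rewrite !deriveE//; last exact: differentiable_comp.
rewrite diff_comp//= deriv1E//.
by rewrite derive1E [RHS]mulrC; congr (_ * _); exact: derive_sqrt.
Qed.

(** The derivative [(2 * sqrt f)^-1 * f'] contains [sqrt f] itself, covered one order lower by
    induction; positivity keeps the denominator nonzero. *)
Lemma Ck_on_sqrt k U f : open U -> (forall x, U x -> 0 < f x) ->
  Ck_on k U f -> Ck_on k U (fun x => Num.sqrt (f x)).
Proof.
move=> oU f0; elim: k => [|k IH] Cf.
  move=> x Ux; apply: continuous_comp; first exact: Cf.
  exact: sqrt_continuous.
have [df cf] := Cf; split=> [x Ux|v].
  by have [] := differentiable_sqrt_comp (f0 x Ux) (df x Ux).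
have C2 := Ck_onM oU (@Ck_on_cst _ _ R k U 2) (IH (Ck_on_le Cf)).
have s0 x : U x -> (cst 2 \* (fun x => Num.sqrt (f x))) x != 0.
  by move=> Ux /=; rewrite mulf_neq0 ?gt_eqF// sqrtr_gt0 f0.
have := Ck_onM oU (Ck_onV oU s0 C2) (cf v).
apply: Ck_on_eq => // x /set_mem Ux /=.
by have [_ ->] := differentiable_sqrt_comp (f0 x Ux) (df x Ux).
Qed.

Lemma smooth_on_vec (W : normedModType R) U (I : finType) (F : I -> V -> R)
    (w : I -> W) : open U -> (forall i, smooth_on U (F i)) ->
  smooth_on U (fun x => \sum_i F i x *: w i).
Proof.
move=> oU sF k; pose G r x := \sum_(i <- r) F i x *: w i.
suff Gr r : Ck_on k U (G r) by exact: Gr.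
elim: r => [|i r IH].
  rewrite (_ : G _ = cst 0); first exact: Ck_on_cst.
  by apply/funext => x; rewrite /G big_nil.
have := Ck_onD oU (Ck_onZl (w i) oU (sF i k)) IH.
by congr Ck_on; apply/funext => x; rewrite /G big_cons.
Qed.

Lemma smooth_on_mx p q U (F : V -> 'M[R]_(p, q)) : open U ->
  (forall i j, smooth_on U (fun x => F x i j)) -> smooth_on U F.
Proof.
move=> oU sF; rewrite (_ : F =
    fun x => \sum_(ij : 'I_p * 'I_q) F x ij.1 ij.2 *: delta_mx ij.1 ij.2).
  by apply: (@smooth_on_vec _ _ _ (fun ij x => F x ij.1 ij.2)).
apply/funext => x; rewrite [LHS]matrix_sum_delta pair_bigA /=.
by apply: eq_bigr => -[i j].
Qed.

Lemma smooth_on_pair (W W' : normedModType R) U (F : V -> W) (G : V -> W') :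
  open U -> smooth_on U F -> smooth_on U G -> smooth_on U (fun x => (F x, G x)).
Proof.
move=> oU sF sG k; move: {sF sG} (sF k) (sG k).
elim: k F G => [|k IH] F G /= => [cF cG x Ux|[dF cF] [dG cG]].
  by apply: cvg_pair; [exact: cF|exact: cG].
split=> [x Ux|v].
  by apply: differentiable_pair; [exact: dF|exact: dG].
apply: Ck_on_eq (IH _ _ (cF v) (cG v)) => // x /set_mem Ux.
have [dFx dGx] := (dF x Ux, dG x Ux).
rewrite !deriveE//; last exact: differentiable_pair.
by rewrite diff_pair.
Qed.

End SmoothFunctions.

(** * Algebras of real functions and the complex functions over them *)

Section FunctionAlgebras.
Context {R : realType} {T : Type}.

(** Instantiated twice, with the smooth functions on an open set and with the real polynomial
    functions, so that the formulas shared by smoothness and algebraicity are checked once. *)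
Definition funalg (S : set (T -> R)) :=
  [/\ forall c, S (cst c), forall f g, S f -> S g -> S (f \+ g) &
      forall f g, S f -> S g -> S (f \* g)].

Variable S : set (T -> R).
Hypothesis S_alg : funalg S.

Lemma funalg_sum (I : finType) (F : I -> T -> R) :
  (forall i, S (F i)) -> S (fun x => \sum_i F i x).
Proof.
case: S_alg => Sc SD _ SF; pose G r x := \sum_(i <- r) F i x.
suff Gr r : S (G r) by exact: Gr.
elim: r => [|i r IH].
  by rewrite (_ : G _ = cst 0)//; apply/funext => x; rewrite /G big_nil.
by have := SD _ _ (SF i) IH; congr S; apply/funext => x; rewrite /G big_cons.
Qed.

Lemma funalgX f k : S f -> S (fun x => f x ^+ k).
Proof.
case: S_alg => Sc _ SM Sf; elim: k => [|k IH]; first exact: Sc.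
by have := SM _ _ Sf IH; congr S; apply/funext => x; rewrite /= exprS.
Qed.

Lemma funalg_prod (I : finType) (P : pred I) (F : I -> T -> R) :
  (forall i, P i -> S (F i)) -> S (fun x => \prod_(i | P i) F i x).
Proof.
case: S_alg => Sc _ SM SF; pose G r x := \prod_(i <- r | P i) F i x.
suff Gr r : S (G r) by exact: Gr.
elim: r => [|i r IH].
  by rewrite (_ : G _ = cst 1)//; apply/funext => x; rewrite /G big_nil.
have [Pi|nPi] := boolP (P i).
  have := SM _ _ (SF i Pi) IH; congr S; apply/funext => x.
  by rewrite /G big_cons Pi.
by move: IH; congr S; apply/funext => x; rewrite /G big_cons (negbTE nPi).
Qed.

Definition cfunalg (F : T -> R[i]) :=
  S (fun x => complex.Re (F x)) /\ S (fun x => complex.Im (F x)).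

Lemma cfunalg_real f : S f -> cfunalg (fun x => (f x)%:C%C).
Proof. by case: S_alg => Sc _ _ Sf; split => //=; exact: Sc. Qed.

Lemma cfunalgM F G : cfunalg F -> cfunalg G -> cfunalg (fun x => F x * G x).
Proof.
case: S_alg => Sc SD SM [F1 F2] [G1 G2].
have SN := SM _ _ (Sc (-1)) (SM _ _ F2 G2).
split; [have := SD _ _ (SM _ _ F1 G1) SN|
        have := SD _ _ (SM _ _ F1 G2) (SM _ _ F2 G1)];
by congr S; apply/funext => x /=; case: (F x) (G x) => [a b] [c d] /=;
   rewrite ?mulN1r.
Qed.

Lemma cfunalg_conj F : cfunalg F -> cfunalg (fun x => (F x)^*%C).
Proof.
case: S_alg => Sc _ SM [F1 F2]; split; last have := SM _ _ (Sc (-1)) F2.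
  by move: F1; congr S; apply/funext => x; case: (F x).
by congr S; apply/funext => x /=; case: (F x) => a b; rewrite mulN1r.
Qed.

Lemma cfunalgX F k : cfunalg F -> cfunalg (fun x => F x ^+ k).
Proof.
move=> SF; elim: k => [|k IH].
  by apply: (@cfunalg_real (cst 1)); case: S_alg.
have := cfunalgM SF IH; congr cfunalg; apply/funext => x.
by rewrite exprS.
Qed.

Lemma cfunalg_hat F a : cfunalg F -> cfunalg (fun x => hat_pow (F x) a).
Proof. by case: a => k SF; apply: cfunalgX => //; exact: cfunalg_conj. Qed.

Lemma cfunalg_prod (I : finType) (F : I -> T -> R[i]) :
  (forall i, cfunalg (F i)) -> cfunalg (fun x => \prod_i F i x).
Proof.
move=> SF; pose G r x := \prod_(i <- r) F i x.
suff Gr r : cfunalg (G r) by exact: Gr.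
elim: r => [|i r IH].
  rewrite (_ : G _ = fun x => 1%:C%C).
    by apply: (@cfunalg_real (cst 1)); case: S_alg.
  by apply/funext => x; rewrite /G big_nil.
by have := cfunalgM (SF i) IH; congr cfunalg; apply/funext => x;
   rewrite /G big_cons.
Qed.

Lemma cfunalg_monomial m (a : 'rV[int]_m) (z : T -> 'rV[R]_(m + m)) :
  (forall i, S (fun x => z x 0 i)) -> cfunalg (fun x => monomial a (z x)).
Proof.
by move=> Sz; apply: cfunalg_prod => i; apply: cfunalg_hat; split; exact: Sz.
Qed.

Lemma funalg_ofC k (F : 'I_k -> T -> R[i]) i j : (forall l, cfunalg (F l)) ->
  S (fun x => ofC (F^~ x) i j).
Proof.
move=> SF; rewrite (ord1 i); case: (split_ordP j) => l ->;
  [have := (SF l).1|have := (SF l).2]; congr S; apply/funext => x;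
  by rewrite /ofC ?row_mxEl ?row_mxEr mxE.
Qed.

Lemma funalg_mulmx p q r (B : 'M[R]_(p, q)) (F : T -> 'M[R]_(q, r)) i j :
  (forall k, S (fun x => F x k j)) -> S (fun x => (B *m F x) i j).
Proof.
case: S_alg => Sc _ SM SF.
rewrite (_ : (fun x => _) = fun x => \sum_k B i k * F x k j).
  by apply: funalg_sum => k; apply: (SM _ _ (Sc (B i k))); exact: SF.
by apply/funext => x; rewrite mxE.
Qed.

Lemma funalg_affine p q (B : 'M[R]_(p, q)) (c : 'cV[R]_p)
    (F : T -> 'cV[R]_q) i j :
  (forall k l, S (fun x => F x k l)) -> S (fun x => (B *m F x + c) i j).
Proof.
move=> SF; have SBF : S (fun x => (B *m F x) i j).
  by apply: funalg_mulmx => k; exact: SF.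
case: S_alg => Sc SD _; have := SD _ _ SBF (Sc (c i j)).
by congr S; apply/funext => x; rewrite [RHS]mxE.
Qed.

Lemma funalg_rho k (z : T -> 'rV[R]_(k + k)) i j :
  (forall l, S (fun x => z x 0 l)) -> S (fun x => rho (z x) i j).
Proof.
move=> Sz; case: (S_alg) => _ SD _.
have S2 l := funalgX 2 (Sz l).
have := SD _ _ (S2 (lshift k i)) (S2 (rshift k i)).
by congr S; apply/funext => x; rewrite mxE.
Qed.

End FunctionAlgebras.

Lemma smooth_on_funalg (R : realType) (V : normedModType R) (U : set V) :
  open U -> funalg [set f : V -> R | smooth_on U f].
Proof.
move=> oU; split=> [c|f g sf sg|f g sf sg] k; first exact: Ck_on_cst.
- exact: Ck_onD.
- exact: Ck_onM.
Qed.

Lemma smooth_on_coord (R : realType) p q (U : set 'M[R]_(p, q)) i j :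
  smooth_on U (fun x => x i j).
Proof.
move=> k; apply: Ck_on_linear => [c x y|]; first by rewrite !mxE.
exact: coord_continuous.
Qed.

Lemma smooth_on_fst_coord (R : realType) (W : normedModType R) p q
    (U : set ('M[R]_(p, q) * W)) i j :
  smooth_on U (fun x => x.1 i j).
Proof.
move=> k; apply: Ck_on_linear => [c x y|]; first by rewrite !mxE.
move=> x; have c := @coord_continuous R p q i j x.1.
by apply: (cvg_comp (fst : 'M[R]_(p, q) * W -> _) (fun M => M i j) _ c);
  exact: cvg_fst.
Qed.

Lemma smooth_on_snd_coord (R : realType) (W : normedModType R) p q
    (U : set (W * 'M[R]_(p, q))) i j :
  smooth_on U (fun x => x.2 i j).
Proof.
move=> k; apply: Ck_on_linear => [c x y|]; first by rewrite !mxE.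
move=> x; have c := @coord_continuous R p q i j x.2.
by apply: (cvg_comp (snd : W * 'M[R]_(p, q) -> _) (fun M => M i j) _ c);
  exact: cvg_snd.
Qed.

(** * Vertices and edges of a simple polytope *)

Lemma unitmx_ker0 (F : fieldType) n (M : 'M[F]_n) :
  (forall v : 'cV[F]_n, M *m v = 0 -> v = 0) -> M \in unitmx.
Proof.
move=> M_inj; rewrite -unitmx_tr -row_free_unit -kermx_eq0.
apply/eqP/row_matrixP => i; rewrite row0; apply: trmx_inj; rewrite trmx0.
apply: M_inj; apply: trmx_inj.
by rewrite trmx_mul trmxK trmx0 -row_mul mulmx_ker row0.
Qed.

(** Used to move a little from a point of P in a direction [d] while keeping finitely many strict
    inequalities. *)
Lemma exists_small (R : realFieldType) (I : finType) (P : pred I)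
    (c d : I -> R) :
  (forall i, P i -> 0 < c i) ->
  exists2 eps, 0 < eps & forall i, P i -> 0 < c i + eps * d i.
Proof.
(* The sum dominates every ratio [|d i| / c i], so [(1 + s)^-1] serves for all indices at once. *)
move=> c0; pose s := \sum_(i | P i) `|d i| / c i.
have s0 : 0 <= s by apply: sumr_ge0 => i Pi; rewrite divr_ge0// ltW// c0.
have s1 : 0 < 1 + s by rewrite ltr_pwDl.
exists (1 + s)^-1 => [|i Pi]; first by rewrite invr_gt0.
have di : `|d i| < c i * (1 + s).
  rewrite -ltr_pdivrMl ?c0// mulrC.
  have: `|d i| / c i <= s.
    rewrite /s (bigD1 i)//= lerDl; apply: sumr_ge0 => j /andP[Pj _].
    by rewrite divr_ge0// ltW// c0.
  by move=> /le_lt_trans; apply; rewrite ltrDr.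
rewrite -(pmulr_lgt0 _ s1) mulrDl mulrAC mulVf ?gt_eqF// mul1r.
by rewrite -[d i]opprK subr_gt0 (le_lt_trans _ di)// -normrN ler_norm.
Qed.

Section Polytope.
Context {R : realType} {n m : nat}.
Variables (A : 'M[R]_(m, n)) (b : 'cV[R]_m).

Definition active (x : 'cV[R]_n) : {set 'I_m} :=
  [set i | ((A *m x + b) i 0 == 0)%R]%SET.

Lemma affineD (x v : 'cV[R]_n) i :
  (A *m (x + v) + b) i 0 = (A *m x + b) i 0 + (A *m v) i 0.
Proof. by rewrite mulmxDr addrAC mxE. Qed.

(** Otherwise the ray from [x] in direction [v] would stay in the bounded set. *)
Lemma bounded_recession (x v : 'cV[R]_n) : bounded_set (polyhedron A b) ->
  polyhedron A b x -> (forall i, 0 <= (A *m v) i 0) -> v = 0.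
Proof.
move=> /pinfty_ex_gt0[M M0 bndM] Px Av; apply/eqP/negPn/negP => v0.
have nv0 : 0 < `|v| by rewrite normr_gt0.
(* Chosen so that the norm of [t *: v] exceeds by 1 the value [M + |x|] that the bound allows. *)
pose t := (M + `|x| + 1) / `|v|.
have t0 : 0 <= t by rewrite divr_ge0 ?addr_ge0// ltW.
have : polyhedron A b (x + t *: v).
  move=> i; rewrite affineD -scalemxAr [X in _ + X]mxE.
  by apply: addr_ge0; [exact: Px|exact: mulr_ge0].
move=> /bndM /= le_M.
have : `|t *: v| <= `|x + t *: v| + `|x|.
  by rewrite -[X in `|X| <= _](addKr x) addrC (le_trans (ler_normB _ _)).
rewrite normrZ (ger0_norm t0) divfK ?gt_eqF// =>
  /le_trans/(_ (lerD le_M (lexx _))).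
by rewrite gerDl ler10.
Qed.

(** Induction on the number of inactive inequalities: as long as some nonzero direction is killed by
    all active rows, moving along it until another inequality becomes tight enlarges the active
    set. *)
Lemma exists_vertex x : bounded_set (polyhedron A b) -> polyhedron A b x ->
  exists y, [/\ polyhedron A b y, active x \subset active y &
    forall v : 'cV[R]_n,
      (forall i, i \in active y -> (A *m v) i 0 = 0) -> v = 0].
Proof.
move=> Pb; have [k] := ubnP #|~: active x|%SET.
elim: k x => // k IH x; rewrite ltnS => le_k Px.
have [ker0|] := pselect (forall v : 'cV[R]_n,
  (forall i, i \in active x -> (A *m v) i 0 = 0) -> v = 0); first by exists x.
move=> /existsNP[v /not_implyP[Av /eqP v0]].
have [i0 Avi0] : exists i, (A *m v) i 0 < 0.
  apply: contrapT => /forallNP Av_ge0; case/eqP: v0.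
  by apply: bounded_recession Pb Px _ => i; rewrite leNgt; apply/negP.
(* The time at which the decreasing inequality [i] becomes tight; the minimum of these times is the
   first hit, so the endpoint is still in P. *)
pose t i := (A *m x + b) i 0 / - (A *m v) i 0.
case: (@Order.TotalTheory.arg_minP _ _ _ i0 (fun i => (A *m v) i 0 < 0) t Avi0).
move=> i Avi t_min.
have t_ge0 : 0 <= t i by apply: divr_ge0; [exact: Px|rewrite oppr_ge0 ltW].
pose y := x + t i *: v.
have yE j : (A *m y + b) j 0 = (A *m x + b) j 0 + t i * (A *m v) j 0.
  by rewrite affineD -scalemxAr [X in _ + X]mxE.
have Py : polyhedron A b y.
  move=> j; rewrite yE; have [Avj|Avj] := leP 0 ((A *m v) j 0).
    by apply: addr_ge0; [exact: Px|exact: mulr_ge0].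
  have := t_min j Avj.
  rewrite -subr_ge0 -(pmulr_lge0 _ (_ : 0 < - (A *m v) j 0)).
    by rewrite mulrBl divfK ?oppr_eq0 ?lt_eqF// mulrN opprK.
  by rewrite oppr_gt0.
have xy : active x \proper active y.
  apply/properP; split.
    apply/fintype.subsetP => j xj; move: (xj); rewrite !inE yE => /eqP->.
    by rewrite Av// mulr0 addr0.
  exists i; rewrite !inE.
    by rewrite yE /t invrN mulrN mulNr divfK ?(lt_eqF Avi)// subrr.
  apply/negP => xi; move: (Avi); rewrite Av ?ltxx//.
  by rewrite inE.
have [|z [Pz yz kerz]] := IH y _ Py.
  by apply: (leq_trans _ le_k); apply: proper_card; rewrite finset.properC.
by exists z; split=> //; exact: fintype.subset_trans (fintype.proper_sub xy) yz.
Qed.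

Section Vertex.
Variables (y : 'cV[R]_n) (Py : polyhedron A b y).
Hypothesis y_ker : forall v : 'cV[R]_n,
  (forall i, i \in active y -> (A *m v) i 0 = 0) -> v = 0.

(** The difference of two points of the face is killed by the active rows, hence zero, so the face
    is the single point [y]. *)
Lemma active_vertex : vertex A b (active y).
Proof.
split=> [|i /(_ y)].
  exists y, 0; split=> [||[]//|z [Pz zI]]; first by rewrite mxrank0.
    by split=> // i; rewrite inE => /eqP.
  exists 0; rewrite mul0mx addr0; apply/eqP; rewrite -subr_eq0; apply/eqP.
  apply: y_ker => i iI; apply: (addrI ((A *m y + b) i 0)).
  rewrite -affineD [y + _]addrC subrK zI// addr0.
  by move: iI; rewrite inE => /eqP.
case; first by split=> // j; rewrite inE => /eqP.
by move=> _ /(_ i); rewrite !inE eqxx => ->.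
Qed.

Variable f : 'I_n -> 'I_m.
Hypotheses (f_inj : injective f)
  (fI : forall i, i \in active y <-> exists k, f k = i).

Lemma vertex_rows_unit : rowsub f A \in unitmx.
Proof.
apply: unitmx_ker0 => v fAv; apply: y_ker => i /fI[k <-].
by move/colP/(_ k): fAv; rewrite mul_rowsub_mx !mxE.
Qed.

(** Releasing the facet [f k] frees exactly one direction, because the rows of the vertex facets
    form an invertible matrix. *)
Lemma vertex_edge k : edge A b (active y :\ f k)%SET.
Proof.
have fy l : (A *m y + b) (f l) 0 = 0.
  by apply/eqP; have /fI : exists l', f l' = f l; [exists l|rewrite inE].
have Au := vertex_rows_unit.
(* The edge direction: it increases the slack at [f k] at unit rate and fixes the slacks at the
   other vertex facets. *)
pose d : 'cV[R]_n := invmx (rowsub f A) *m delta_mx k 0.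
have Ad l : (A *m d) (f l) 0 = (l == k)%:R.
  have : (rowsub f A *m d) l 0 = (l == k)%:R.
    by rewrite /d mulKVmx// mxE eqxx andbT.
  by rewrite mul_rowsub_mx mxE.
have y0 i : i \notin active y -> 0 < (A *m y + b) i 0.
  by rewrite inE lt_def => ->; exact: Py.
have [eps eps0 epsP] := exists_small (fun i => (A *m d) i 0) y0.
pose V := eps *: d.
have AV i : (A *m V) i 0 = eps * (A *m d) i 0 by rewrite -scalemxAr mxE.
have yV : face A b (active y :\ f k)%SET (y + V).
  split=> [i|i]; rewrite affineD AV.
    have [/fI[l <-]|/epsP/ltW//] := boolP (i \in active y).
    by rewrite fy add0r Ad mulr_ge0 ?ler0n// ltW.
  rewrite in_setD1 => /andP[ik /fI[l li]]; move: ik; rewrite -li fy Ad.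
  by case: (l =P k) => [->|_ _]; rewrite ?eqxx// mulr0 addr0.
split=> [|i yVi].
  exists y, V; split.
  - rewrite -mxrank_tr rank_rV trmx_eq0.
    suff -> : V != 0 by [].
    apply: contraTneq isT => V0; have := AV (f k).
    by rewrite V0 mulmx0 mxE Ad eqxx mulr1 => /eqP; rewrite lt_eqF.
  - by split=> // i; rewrite in_setD1 inE => /andP[_ /eqP].
  - by move=> j; rewrite ord1 col_id.
  (* The slack at [f k] is the coordinate along the edge, and [V] has slack [eps] there. Equality is
     then tested on the vertex rows. *)
  - move=> z [Pz zJ]; exists ((A *m (z - y)) (f k) 0 / eps)%:M.
    apply/eqP; rewrite addrC -subr_eq; apply/eqP.
    apply: (can_inj (mulKmx Au)).
    apply/colP => l; rewrite !mul_rowsub_mx mul_mx_scalar -scalemxAr.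
    rewrite [LHS]mxE [RHS]mxE [RHS]mxE AV mulrA divfK ?gt_eqF// Ad.
    have [->|lk] := eqVneq l k; first by rewrite mulr1.
    have := affineD y (z - y) (f l); rewrite [y + _]addrC subrK fy add0r => <-.
    rewrite zJ ?mulr0// in_setD1 (inj_eq f_inj) lk/=; apply/fI.
    by exists l.
(* At [y + V] the slacks at [f k] and at all inactive facets are positive, so a facet containing the
   edge is one of the remaining vertex facets. *)
have [_ /(_ i)] := yVi _ yV; rewrite inE eqxx => /(_ isT) yVi0.
rewrite in_setD1; have iI : i \in active y.
  by apply: contraT => /epsP; rewrite -AV -affineD yVi0 ltxx.
rewrite iI andbT; apply: contra_eqN yVi0 => /eqP ->.
by rewrite affineD fy add0r AV Ad eqxx mulr1 gt_eqF.
Qed.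

End Vertex.

(** Up to sign the edge vector is row [k] of the inverse of [colsub f Lam], the member of the dual
    basis that pairs to 1 with column [f k] and to 0 with the others. *)
Lemma edge_vector_vertex (Lam : 'M[int]_(n, m)) (f : 'I_n -> 'I_m)
    (J : {set 'I_m}) k :
  colsub f Lam \in unitmx ->
  (forall j, j \in J -> exists2 l, l != k & f l = j) ->
  exists w eps, [/\ is_edge_vector Lam J w, eps = 1 \/ eps = -1 &
    forall l, (w *m Lam) 0 (f l) = if l == k then eps else 0].
Proof.
move=> LamU fJ; pose v := row k (invmx (colsub f Lam)).
have vf l : (v *m Lam) 0 (f l) = (l == k)%:R.
  have : (v *m colsub f Lam) 0 l = (l == k)%:R.
    by rewrite /v -row_mul mulVmx// !mxE eq_sym.
  by rewrite mulmx_colsub mxE.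
(* A common divisor of the entries divides the pairing with column [f k], which is 1 for [v]. *)
have v_prim (e : int) : `|e|%N = 1%N -> primitive (e *: v).
  move=> e1; apply/eqP; rewrite -dvdn1.
  pose g := \big[gcdn/0%N]_i absz ((e *: v) 0 i); rewrite -/g.
  have dv i : (g %| (v 0%R i))%Z.
    by rewrite dvdzE /g (bigD1 i)//= mxE abszM e1 mul1n dvdn_gcdl.
  have : (g %| (v *m Lam)%R 0%R (f k))%Z.
    rewrite mxE; apply: (big_ind (fun a => (g %| a)%Z)) =>
      [|a c da dc|i _]; first exact: dvdz0.
      exact: rpredD.
    exact: dvdz_mulr.
  by rewrite vf eqxx dvdzE absz_nat.
have [j0 vj0] : exists j, (v *m Lam) 0 j != 0.
  by exists (f k); rewrite vf eqxx.
(* The sign convention looks at the first nonzero pairing, so [eps] is the sign found at the least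
   such index. *)
have [j vj j_min] :=
  @arg_minnP _ j0 (fun j => (v *m Lam) 0 j != 0) (@nat_of_ord m) vj0.
pose eps := sgz ((v *m Lam) 0 j).
have eps1 : eps = 1 \/ eps = -1.
  by rewrite /eps; case: sgzP vj => // _ _; [left|right].
exists (eps *: v), eps; split=> //.
  split=> [|i iJ|]; first by apply: v_prim; case: eps1 => ->.
    by have [l lk <-] := fJ i iJ; rewrite -scalemxAl mxE vf (negbTE lk) mulr0.
  exists j => [|i ij]; rewrite -scalemxAl mxE.
    by rewrite /eps -sgrz -normrEsg normr_gt0.
  suff -> : (v *m Lam) 0 i = 0 by rewrite mulr0.
  by apply: contraTeq ij => /j_min; rewrite -leqNgt.
by move=> l; rewrite -scalemxAl mxE vf; case: eqP; rewrite ?mulr1 ?mulr0.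
Qed.

(** The vertex comes from [exists_vertex] applied to [x], so every facet through [x] passes through
    it; hence the strict inequalities off [codom f]. Simplicity gives the [n] facets that [f]
    enumerates. *)
Lemma vertex_chart_data (Lam : 'M[int]_(n, m)) q (w : 'I_q -> 'rV[int]_n) x :
  simple_polytope A b -> independence A b Lam ->
  range w = edge_vectors A b Lam -> polyhedron A b x ->
  exists (f : 'I_n -> 'I_m) (e : 'I_n -> 'I_q) (eps : 'I_n -> int),
    [/\ injective f, rowsub f A \in unitmx,
        forall j, j \notin codom f -> 0 < (A *m x + b) j 0,
        colsub f Lam \in unitmx &
        forall k, (eps k = 1 \/ eps k = -1) /\
          forall l, (w (e k) *m Lam) 0 (f l) = if l == k then eps k else 0].
Proof.
move=> [Pb _ _ P_simple] Lam_indep w_range Px.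
have [y [Py xy kery]] := exists_vertex Pb Px.
have vert_y := active_vertex Py kery.
have cardI := P_simple _ vert_y.
pose f (k : 'I_n) := enum_val (cast_ord (esym cardI) k).
have f_inj : injective f by move=> k l /enum_val_inj/cast_ord_inj.
have fI i : i \in active y <-> exists k, f k = i.
  split=> [iI|[k <-]]; last exact: enum_valP.
  exists (cast_ord cardI (enum_rank_in iI i)).
  by rewrite /f cast_ordK enum_rankK_in.
have LamU : colsub f Lam \in unitmx.
  by rewrite unitmxE; case: (Lam_indep _ f vert_y f_inj fI) => ->.
have /choice[e_eps e_epsP] k : exists p : 'I_q * int, (p.2 = 1 \/ p.2 = -1) /\
    forall l, (w p.1 *m Lam) 0 (f l) = if l == k then p.2 else 0.
  have [j|v [eps [vJ eps1 vf]]] :=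
    @edge_vector_vertex Lam f (active y :\ f k)%SET k LamU.
    rewrite in_setD1 => /andP[jk /fI[l lj]]; exists l => //.
    by apply: contraNneq jk => <-; rewrite lj.
  have [e _ ew] : range w v.
    rewrite w_range; exists (active y :\ f k)%SET => //.
    exact: vertex_edge.
  by exists (e, eps); rewrite /= ew.
exists f, (fun k => (e_eps k).1), (fun k => (e_eps k).2); split=> //.
  exact: (vertex_rows_unit kery).
move=> j jf; rewrite lt_def Px andbT; apply: contraT; rewrite negbK => /eqP xj.
have /fI[k kj] : j \in active y.
  by apply: (fintype.subsetP xy); rewrite inE xj.
by move: jf; rewrite -kj codom_f.
Qed.

End Polytope.

(** * Torus characters and monomials *)

Section ComplexNorm.
Context {R : realType}.
Implicit Types z t : R[i].

Lemma conjc_unit t : `|t| = 1 -> (t^*)%C = t^-1.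
Proof.
move=> t1; have t0 : t != 0 by rewrite -normr_eq0 t1 oner_eq0.
apply: (mulfI t0); rewrite divff//.
transitivity (`|t| ^+ 2); last by rewrite t1 expr1n.
rewrite -add_Re2_Im2; case: t {t1 t0} => x y /=; simpc.
by rewrite -!expr2 mulrC addNr.
Qed.

(** On the unit circle conjugation is inversion, so the conjugates used for negative exponents still
    give the integral character. *)
Lemma hat_powM t z a : `|t| = 1 -> hat_pow (t * z) a = t ^ a * hat_pow z a.
Proof.
move=> t1; case: a => k /=; first by rewrite exprMn.
by rewrite rmorphM /= (conjc_unit t1) exprMn exprVn.
Qed.

Lemma hat_pow_unit t a : `|t| = 1 -> hat_pow t a = t ^ a.
Proof.
move=> t1; rewrite -[t in LHS]mulr1 hat_powM//.
by case: a => k; rewrite /hat_pow ?conjc1 expr1n mulr1.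
Qed.

Lemma hat_pow_real (x : R) a : hat_pow (x%:C)%C a = ((x ^+ `|a|)%:C)%C.
Proof. by case: a => k; rewrite /hat_pow ?conjc_real rmorphXn. Qed.

(** For these exponents [hat_pow] is the identity or conjugation: an involution, multiplicative, and
    trivial on reals. *)
Lemma hat_pow_sign (x : R) z a : a = 1 \/ a = -1 ->
  hat_pow (hat_pow z a * (x%:C)%C) a = z * (x%:C)%C.
Proof.
have hat1 y : hat_pow y 1 = y by exact: expr1.
have hatN1 y : hat_pow y (-1) = (y^*)%C by exact: expr1.
case=> ->; first by rewrite !hat1.
by rewrite !hatN1 rmorphM; congr (_ * _); [exact: conjcK|exact: conjc_real].
Qed.

End ComplexNorm.

Section TorusAlgebra.
Context {R : realType}.

Lemma torus_neq0 k (t : 'rV[R[i]]_k) j : torus t -> t 0 j != 0.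
Proof. by move=> t1; rewrite -normr_eq0 t1 oner_eq0. Qed.

Lemma character_norm k (t : 'rV[R[i]]_k) a : torus t -> `|character t a| = 1.
Proof.
move=> t1; rewrite normr_prod big1// => j _.
by case: (a 0 j) => c /=; rewrite ?normfV normrX t1 expr1n ?invr1.
Qed.

Lemma torus_torus_hom p k (B : 'M[int]_(p, k)) (t : 'rV[R[i]]_k) :
  torus t -> torus (torus_hom B t).
Proof. by move=> t1 j; rewrite mxE character_norm. Qed.

Lemma characterD k (t : 'rV[R[i]]_k) a a' : torus t ->
  character t (a + a') = character t a * character t a'.
Proof.
move=> t1; rewrite -big_split; apply: eq_bigr => j _ /=.
by rewrite mxE expfzDr ?torus_neq0.
Qed.

Lemma character_torus_hom p k (B : 'M[int]_(p, k)) (t : 'rV[R[i]]_k) a :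
  torus t -> character (torus_hom B t) a = character t (a *m B).
Proof.
move=> t1; transitivity (\prod_i \prod_j t 0 j ^ (B i j * a 0 i)).
  apply: eq_bigr => i _; rewrite mxE /character.
  transitivity (\prod_j (t 0 j ^ row i B 0 j) ^ a 0 i).
    apply: (big_morph (fun x => x ^ a 0 i)) => [x y|]; last exact: exp1rz.
    exact: expfzMl.
  by apply: eq_bigr => j _; rewrite mxE exprz_exp.
rewrite exchange_big; apply: eq_bigr => j _; rewrite mxE.
rewrite (big_morph (fun c => t 0 j ^ c) (op1 := *%R) (id1 := 1)) => [|c d|].
- by apply: eq_bigr => i _; rewrite mulrC.
- by rewrite expfzDr ?torus_neq0.
- by rewrite expr0z.
Qed.

Lemma torus_hom_comp p k l (B : 'M[int]_(p, k)) (C : 'M[int]_(k, l))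
    (t : 'rV[R[i]]_l) :
  torus t -> torus_hom B (torus_hom C t) = torus_hom (B *m C) t.
Proof.
by move=> t1; apply/rowP => i; rewrite !mxE character_torus_hom// row_mul.
Qed.

Lemma character_delta k (t : 'rV[R[i]]_k) j :
  character t (delta_mx 0 j) = t 0 j.
Proof.
rewrite /character (bigD1 j)//= mxE !eqxx expr1z big1 ?mulr1// => i ij.
by rewrite mxE eqxx (negbTE ij) expr0z.
Qed.

Lemma character0 k (t : 'rV[R[i]]_k) : character t 0 = 1.
Proof. by rewrite /character big1// => j _; rewrite mxE expr0z. Qed.

Lemma torus_hom1 k (t : 'rV[R[i]]_k) : torus_hom 1%:M t = t.
Proof. by apply/rowP => i; rewrite mxE row1 character_delta. Qed.

Lemma monomial_torus_act k (t : 'rV[R[i]]_k) a (z : 'rV[R]_(k + k)) :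
  torus t -> monomial a (torus_act t z) = character t a * monomial a z.
Proof.
move=> t1; rewrite -big_split; apply: eq_bigr => j _ /=.
by rewrite ofCK hat_powM.
Qed.

Lemma rho_norm k (z : 'rV[R]_(k + k)) j :
  (((rho z) j 0)%:C)%C = `|coordC z j| ^+ 2.
Proof. by rewrite -add_Re2_Im2 mxE. Qed.

Lemma rho_torus_act k (t : 'rV[R[i]]_k) (z : 'rV[R]_(k + k)) :
  torus t -> rho (torus_act t z) = rho z.
Proof.
move=> t1; apply/colP => j; apply: (@complexI R).
by rewrite !rho_norm ofCK normrM t1 mul1r.
Qed.

Lemma moment_angle_torus_act n m (A : 'M[R]_(m, n)) (b : 'cV[R]_m)
    (t : 'rV[R[i]]_m) (z : moment_angle A b) : torus t ->
  exists z' : moment_angle A b, val z' = torus_act t (val z).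
Proof.
move=> t1; have : torus_act t (val z) \in moment_angle_set A b.
  rewrite inE; have [x Px xz] : moment_angle_set A b (val z).
    exact/set_mem/(valP z).
  by exists x; rewrite ?rho_torus_act.
by move=> tz; exists (SigSub tz).
Qed.

End TorusAlgebra.

(** * Equality of classes in the orbit space *)

Section OrbitSpace.
Context {R : realType} {n m : nat}.
Variables (A : 'M[R]_(m, n)) (b : 'cV[R]_m) (Lam : 'M[int]_(n, m)).

Lemma pi_lP (z z' : moment_angle A b) : pi_l Lam z = pi_l Lam z' <->
  exists2 t, torus_ker Lam t & val z = torus_act t (val z').
Proof.
split=> [zz'|].
  have /eqmodP/asboolP : z' = z %[mod {eq_quot orbit_equiv A b Lam}] by [].
  by [].
move=> zz'; symmetry.
by have /eqmodP : same_orbit Lam z' z by exact/asboolP.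
Qed.

Lemma pi_l_repr (p : quasitoric A b Lam) : pi_l Lam (repr p) = p.
Proof. exact: reprK. Qed.

End OrbitSpace.

(** * The chart at a vertex *)

Lemma open_forall (T : topologicalType) (R : realType) (I : finType)
    (P : pred I) (F : I -> T -> R) :
  (forall i, P i -> continuous (F i)) ->
  open [set x | forall i, P i -> 0 < F i x].
Proof.
move=> Fc; rewrite openE => x Fx; apply: filter_forall => i.
have [Pi|nPi] := boolP (P i); last by apply: nearW.
by apply: filterS (cvgr_gt _ (Fc i Pi x) 0 (Fx i Pi)) => y + _.
Qed.

Lemma smooth_on_open_preimage (R : realType) (V W : normedModType R)
    (U : set V) (D : set W) (F : V -> W) :
  open U -> smooth_on U F -> open D -> open (U `&` F @^-1` D).
Proof.
move=> oU sF oD; rewrite openE => x [Ux Dx]; apply: filterI.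
  exact: (open_nbhs_nbhs (conj oU Ux)).
exact: (sF 0%N x Ux D (open_nbhs_nbhs (conj oD Dx))).
Qed.

Section Chart.
Context {R : realType} {n m q : nat}.
Variables (A : 'M[R]_(m, n)) (b : 'cV[R]_m) (Lam : 'M[int]_(n, m)).
Variables (w : 'I_q -> 'rV[int]_n).
Variables (f : 'I_n -> 'I_m) (e : 'I_n -> 'I_q) (eps : 'I_n -> int).
Hypotheses (f_inj : injective f) (A_unit : rowsub f A \in unitmx).
Hypothesis Lam_unit : colsub f Lam \in unitmx.
Hypothesis eps_sign : forall k, eps k = 1 \/ eps k = -1.
Hypothesis w_f : forall k l,
  (w (e k) *m Lam) 0 (f l) = if l == k then eps k else 0.

Local Notation M := (quasitoric A b Lam).

(** Recovers a point of R^n from its [n] slacks at the vertex facets, which are affine coordinates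
    there. *)
Definition facet_inv (c : 'cV[R]_n) : 'cV[R]_n :=
  invmx (rowsub f A) *m (c - rowsub f b).

Lemma rowsub_affine x : rowsub f (A *m x + b) = rowsub f A *m x + rowsub f b.
Proof. by rewrite mul_rowsub_mx; apply/colP => k; rewrite !mxE. Qed.

Lemma facet_invE x : facet_inv (rowsub f (A *m x + b)) = x.
Proof. by rewrite /facet_inv rowsub_affine addrK mulKmx. Qed.

Lemma facet_invK c : rowsub f (A *m facet_inv c + b) = c.
Proof. by rewrite rowsub_affine mulKVmx// subrK. Qed.

Lemma rho_P_eq (z : moment_angle A b) x : polyhedron A b x ->
  A *m x + b = rho (val z) -> rho_P z = x.
Proof.
move=> Px xz; rewrite -[x]facet_invE xz.
by rewrite -(rho_P_spec z).2 facet_invE.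
Qed.

Lemma rho_PE (z : moment_angle A b) :
  rho_P z = facet_inv (rowsub f (rho (val z))).
Proof. by rewrite -(rho_P_spec z).2 facet_invE. Qed.

Lemma rho_coordC k l (z : 'rV[R]_(k + k)) (z' : 'rV[R]_(l + l)) i j :
  coordC z i = coordC z' j -> rho z i 0 = rho z' j 0.
Proof. by move=> zz'; apply: (@complexI R); rewrite !rho_norm zz'. Qed.

Definition chart_pt (u : 'rV[R]_(n + n)) := facet_inv (rho u).

Definition interior_pts : set 'cV[R]_n :=
  [set x | forall i, i \notin codom f -> 0 < (A *m x + b) i 0].

Definition chart_dom : set 'rV[R]_(n + n) := chart_pt @^-1` interior_pts.

(** The slice meeting each K-orbit over the chart once: the coordinates off the vertex are the
    positive roots of the slacks, which [u] determines through [chart_pt]. *)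
Definition chart_section (u : 'rV[R]_(n + n)) : 'rV[R]_(m + m) :=
  ofC (fun i => if [pick k | f k == i] is Some k then coordC u k
                else ((Num.sqrt ((A *m chart_pt u + b) i 0))%:C)%C).

Lemma chart_section_in u k : coordC (chart_section u) (f k) = coordC u k.
Proof.
rewrite ofCK; case: pickP => [l /eqP/f_inj->//|/(_ k)].
by rewrite eqxx.
Qed.

Lemma chart_section_out u i : i \notin codom f ->
  coordC (chart_section u) i = ((Num.sqrt ((A *m chart_pt u + b) i 0))%:C)%C.
Proof.
move=> fi; rewrite ofCK; case: pickP => // l /eqP li.
by move: fi; rewrite -li codom_f.
Qed.

Lemma rho_chart_section u : chart_dom u ->
  rho (chart_section u) = A *m chart_pt u + b.
Proof.
move=> domu; apply/colP => i.
have [/codomP[k ->]|fi] := boolP (i \in codom f).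
  rewrite (rho_coordC (chart_section_in u k)).
  by have /colP/(_ k) := facet_invK (rho u); rewrite mxE.
apply: (@complexI R); rewrite rho_norm chart_section_out//.
rewrite normc_def /= expr0n addr0 -rmorphXn /=.
by rewrite !sqr_sqrtr// ?ltW ?domu// sqr_ge0.
Qed.

Lemma polyhedron_chart_pt u : chart_dom u -> polyhedron A b (chart_pt u).
Proof.
move=> domu i; rewrite -rho_chart_section// mxE.
by rewrite addr_ge0 ?sqr_ge0.
Qed.

Lemma chart_section_lift u : chart_dom u ->
  exists2 z : moment_angle A b, val z = chart_section u & rho_P z = chart_pt u.
Proof.
move=> domu; have su : chart_section u \in moment_angle_set A b.
  rewrite inE; exists (chart_pt u); first exact: polyhedron_chart_pt.
  by rewrite rho_chart_section.
exists (SigSub su) => //; apply: rho_P_eq; first exact: polyhedron_chart_pt.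
by rewrite rho_chart_section.
Qed.

Variable p0 : M.

(* Where the section leaves the moment-angle manifold, [chart] has the junk
   value [p0]. *)
Definition chart (u : 'rV[R]_(n + n)) : M :=
  xget p0 [set p | exists2 z, val z = chart_section u & pi_l Lam z = p].

Lemma chartP u : chart_dom u -> exists z : moment_angle A b,
  [/\ val z = chart_section u, rho_P z = chart_pt u & pi_l Lam z = chart u].
Proof.
move=> /chart_section_lift[z zu zx]; exists z; split=> //.
rewrite /chart; case: xgetP => [p -> [z' z'u <-]|/(_ (pi_l Lam z))[]].
  by congr pi_l; apply: val_inj; rewrite zu z'u.
by exists z.
Qed.

(** The factor of the monomial of [e k] due to the coordinates off the vertex. On the slice these
    are positive reals, so only the absolute values of the exponents matter. *)
Definition edge_scale k (x : 'cV[R]_n) : R :=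
  \prod_(i | i \notin codom f)
    Num.sqrt ((A *m x + b) i 0) ^+ absz ((w (e k) *m Lam) 0 i).

(** The left inverse of the embedding in the chart. The power [eps k] undoes the conjugation that
    occurs when the edge vector has the negative sign. *)
Definition chart_inv (y : 'cV[R]_n * 'rV[R]_(q + q)) : 'rV[R]_(n + n) :=
  ofC (fun k => hat_pow (coordC y.2 (e k)) (eps k) *
                (((edge_scale k y.1)^-1)%:C)%C).

Lemma edge_scale_gt0 k x : interior_pts x -> 0 < edge_scale k x.
Proof.
by move=> xI; apply: prodr_gt0 => i fi; rewrite exprn_gt0// sqrtr_gt0 xI.
Qed.

Lemma monomial_chart_section u k : monomial (w (e k) *m Lam) (chart_section u) =
  hat_pow (coordC u k) (eps k) * ((edge_scale k (chart_pt u))%:C)%C.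
Proof.
rewrite /monomial (bigD1 (f k))//= w_f eqxx chart_section_in; congr (_ * _).
rewrite rmorph_prod big_mkcond [RHS]big_mkcond; apply: eq_bigr => i _ /=.
have [/codomP[l ->]|fi] /= := boolP (i \in codom f).
  by rewrite w_f (inj_eq f_inj); case: eqP.
rewrite chart_section_out// hat_pow_real.
by case: eqP fi => // ->; rewrite codom_f.
Qed.

Lemma chart_invK u : chart_dom u ->
  chart_inv (chart_pt u,
             ofC (fun j => monomial (w j *m Lam) (chart_section u))) = u.
Proof.
move=> domu; rewrite -[RHS]coordCK; congr ofC; apply/funext => k /=.
rewrite ofCK monomial_chart_section hat_pow_sign//.
by rewrite -mulrA -rmorphM /= divff ?mulr1// gt_eqF// edge_scale_gt0.
Qed.

(* The element of K that makes the coordinates of z off the vertex positive is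
   [torus_hom normal_hom (phase z)]. *)
Definition phase (z : 'rV[R]_(m + m)) : 'rV[R[i]]_m :=
  \row_i (if i \in codom f then 1
          else coordC z i * (((Num.sqrt (rho z i 0))^-1)%:C)%C).

(** The first product before [Lam] is a right inverse of [Lam] with nonzero rows only in [codom f].
    Hence the image lies in the kernel of [Lam], while the rows outside [codom f] are those of
    [- 1%:M] and so invert the phases there. *)
Definition normal_hom : 'M[int]_m :=
  colsub f 1%:M *m invmx (colsub f Lam) *m Lam - 1%:M.

(** The product is the [f k] coordinate of [torus_hom normal_hom (phase z)] on [chart_open], written
    with [hat_pow] instead of integral powers so that no inverse of a complex number enters the
    smoothness proof. *)
Definition chart_coord (z : 'rV[R]_(m + m)) : 'rV[R]_(n + n) :=
  ofC (fun k => (\prod_i hat_pow (phase z 0 i) (normal_hom (f k) i)) *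
                coordC z (f k)).

Definition chart_open : set 'rV[R]_(m + m) :=
  [set z | forall i, i \notin codom f -> 0 < rho z i 0].

Lemma colsub_invmxK :
  Lam *m (colsub f 1%:M *m invmx (colsub f Lam)) = 1%:M.
Proof. by rewrite mulmxA mulmx_colsub mulmx1 mulmxV. Qed.

Lemma Lam_normal_hom : Lam *m normal_hom = 0.
Proof. by rewrite mulmxBr mulmxA colsub_invmxK mul1mx mulmx1 subrr. Qed.

Lemma torus_phase z : chart_open z -> torus (phase z).
Proof.
move=> zO i; rewrite mxE; case: ifPn => [_|fi]; first exact: normr1.
rewrite normrM [X in _ * X]normc_def /= expr0n addr0 sqrtr_sqr.
rewrite normfV (ger0_norm (sqrtr_ge0 _)).
rewrite normc_def -rmorphM /= [rho _ _ _]mxE divff// gt_eqF// sqrtr_gt0.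
by have := zO i fi; rewrite mxE.
Qed.

(** The element [t] of K built from the phases carries [z] to the slice point over [u], so both have
    the same class. *)
Lemma chart_coordP (z : moment_angle A b) : chart_open (val z) ->
  chart_dom (chart_coord (val z)) /\ chart (chart_coord (val z)) = pi_l Lam z.
Proof.
move=> zO; set u := chart_coord _; set y := val z.
have th1 := torus_phase zO.
pose t := torus_hom normal_hom (phase y).
have t1 : torus t by exact: torus_torus_hom.
have Kt : torus_ker Lam t.
  split=> //; rewrite torus_hom_comp// Lam_normal_hom.
  by apply/rowP => i; rewrite !mxE row0 character0.
have uE k : coordC u k = t 0 (f k) * coordC y (f k).
  rewrite ofCK mxE; congr (_ * _); apply: eq_bigr => i _.
  by rewrite hat_pow_unit// [row _ _ _ _]mxE.
(* The entries of [t] have modulus 1, so [u] has the moduli of [z] at the vertex facets, and these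
   determine the point of P. *)
have xE : chart_pt u = rho_P z.
  rewrite rho_PE; congr facet_inv; apply/colP => k; rewrite [RHS]mxE.
  by apply: (@complexI R); rewrite !rho_norm uE normrM t1 mul1r.
have domu : chart_dom u.
  by move=> i /zO; rewrite xE (rho_P_spec z).2.
split=> //; have [z' [z'u _ <-]] := chartP domu.
apply/pi_lP; exists t => //; rewrite z'u -[LHS]coordCK; congr ofC.
apply/funext => i; have [/codomP[k ->]|fi] := boolP (i \in codom f).
  by rewrite chart_section_in uE.
rewrite chart_section_out// xE (rho_P_spec z).2.
(* Off the vertex, row [i] of [normal_hom] is minus a unit row, as [colsub f 1%:M] has zero row
   [i]. *)
have tE : t 0 i = (phase y 0 i)^-1.
  rewrite mxE [row i _](_ : _ = - delta_mx 0 i).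
    apply: (mulIf (torus_neq0 i th1)); rewrite -[X in _ * X]character_delta.
    by rewrite -characterD// addNr character0 mulVf ?torus_neq0.
  rewrite /normal_hom linearB /= row1 -mulmxA row_mul.
  rewrite [row i _](_ : _ = 0) ?mul0mx ?sub0r//; apply/rowP => k; rewrite !mxE.
  by case: eqP fi => // ->; rewrite codom_f.
rewrite tE [phase _ _ _]mxE (negbTE fi) invfM -rmorphV ?unitfE; last first.
  by rewrite invr_eq0 gt_eqF// sqrtr_gt0 zO.
rewrite /= invrK mulrAC mulVf ?mul1r//.
by rewrite -normr_eq0 -sqrf_eq0 -rho_norm (inj_eq (@complexI R)) gt_eqF// zO.
Qed.

End Chart.

Section FunctionAlgebraChart.
Context {R : realType} {T : Type}.
Variable S : set (T -> R).
Hypothesis S_alg : funalg S.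

Lemma funalg_facet_inv n m (A : 'M[R]_(m, n)) b (f : 'I_n -> 'I_m)
    (F : T -> 'cV[R]_n) i j :
  (forall k l, S (fun x => F x k l)) -> S (fun x => facet_inv A b f (F x) i j).
Proof.
move=> SF; have := funalg_affine S_alg (invmx (rowsub f A))
  (- (invmx (rowsub f A) *m rowsub f b)) i j SF.
by congr S; apply/funext => x; rewrite /facet_inv mulmxBr.
Qed.

End FunctionAlgebraChart.

(** * Smoothness of the chart, its section and its inverses *)

Section ChartSmooth.
Context {R : realType} {n m q : nat}.
Variables (A : 'M[R]_(m, n)) (b : 'cV[R]_m) (Lam : 'M[int]_(n, m)).
Variables (w : 'I_q -> 'rV[int]_n).
Variables (f : 'I_n -> 'I_m) (e : 'I_n -> 'I_q) (eps : 'I_n -> int).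
Hypotheses (f_inj : injective f) (A_unit : rowsub f A \in unitmx).
Hypothesis Lam_unit : colsub f Lam \in unitmx.
Hypothesis eps_sign : forall k, eps k = 1 \/ eps k = -1.
Hypothesis w_f : forall k l,
  (w (e k) *m Lam) 0 (f l) = if l == k then eps k else 0.

Local Notation M := (quasitoric A b Lam).
Local Notation chart_pt := (chart_pt A b f).
Local Notation chart_dom := (chart_dom A b f).
Local Notation chart_section := (chart_section A b f).
Local Notation chart_open := (@chart_open R n m f).
Local Notation interior_pts := (interior_pts A b f).

Lemma smooth_affine_pt (V : normedModType R) (U : set V) (F : V -> 'cV[R]_n) i :
  open U -> (forall k l, smooth_on U (fun x => F x k l)) ->
  smooth_on U (fun x => (A *m F x + b) i 0).
Proof. by move=> oU sF; exact: (funalg_affine (smooth_on_funalg oU)). Qed.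

Lemma smooth_chart_pt U i j : open U -> smooth_on U (fun u => chart_pt u i j).
Proof.
move=> oU; apply: (funalg_facet_inv (smooth_on_funalg oU)) => k l.
apply: (funalg_rho (smooth_on_funalg oU)) => h.
exact: smooth_on_coord.
Qed.

Lemma open_chart_dom : open chart_dom.
Proof.
apply: (open_forall (F := fun i u => (A *m chart_pt u + b) i 0)) => i _ u.
(* Continuity is the order 0 instance of smoothness on the whole space. *)
have := @smooth_affine_pt _ setT chart_pt i openT _.
move=> /(_ (fun k l => @smooth_chart_pt setT k l openT)) /(_ 0%N u); exact.
Qed.

Lemma open_chart_open : open chart_open.
Proof.
apply: (open_forall (F := fun i (z : 'rV[R]_(m + m)) => rho z i 0)) => i _ z.
have := funalg_rho (smooth_on_funalg openT) i 0
  (fun l => @smooth_on_coord R 1 (m + m) setT 0 l).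
by move=> /(_ 0%N z); exact.
Qed.

Lemma open_interior_fst (W : normedModType R) :
  open [set y : 'cV[R]_n * W | interior_pts y.1].
Proof.
apply: (open_forall
  (F := fun i (y : 'cV[R]_n * W) => (A *m y.1 + b) i 0)) => i _ y.
have := @smooth_affine_pt _ setT (fst : 'cV[R]_n * W -> _) i openT _.
move=> /(_ (fun k l => @smooth_on_fst_coord R W n 1 setT k l)).
by move=> /(_ 0%N y); exact.
Qed.

Lemma smooth_chart_section_coord i j :
  smooth_on chart_dom (fun u => chart_section u i j).
Proof.
have S_alg := smooth_on_funalg open_chart_dom.
apply: (funalg_ofC (F := fun i u => if [pick k | f k == i] is Some k then
  coordC u k else ((Num.sqrt ((A *m chart_pt u + b) i 0))%:C)%C)) => l.
case: pickP => [k _|fl]; first by split; exact: smooth_on_coord.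
apply: (cfunalg_real S_alg) => k.
apply: Ck_on_sqrt; first exact: open_chart_dom.
  by move=> u; apply; apply/codomP => -[h lh]; have := fl h; rewrite lh eqxx.
apply: smooth_affine_pt => [|h h']; first exact: open_chart_dom.
apply: smooth_chart_pt; exact: open_chart_dom.
Qed.

Lemma smooth_chart_section : smooth_on chart_dom chart_section.
Proof.
apply: smooth_on_mx => [|i j]; first exact: open_chart_dom.
exact: smooth_chart_section_coord.
Qed.

Lemma smooth_chart_coord : smooth_on chart_open (chart_coord Lam f).
Proof.
have S_alg := smooth_on_funalg open_chart_open.
apply: smooth_on_mx => [|i j]; first exact: open_chart_open.
apply: (funalg_ofC (F := fun k z => (\prod_i hat_pow (phase f z 0 i)
  (normal_hom Lam f (f k) i)) * coordC z (f k))) => l.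
apply: (cfunalgM S_alg); last by split; exact: smooth_on_coord.
apply: (cfunalg_prod S_alg) => k; apply: (cfunalg_hat S_alg).
have [fk|fk] := boolP (k \in codom f).
  have -> : (fun z : 'rV[R]_(m + m) => phase f z 0 k) =
      fun z => ((cst (1 : R) z)%:C)%C.
    by apply/funext => z; rewrite mxE fk.
  by apply: (cfunalg_real S_alg); case: S_alg.
have -> : (fun z : 'rV[R]_(m + m) => phase f z 0 k) =
    fun z => coordC z k * (((Num.sqrt (rho z k 0))^-1)%:C)%C.
  by apply/funext => z; rewrite mxE (negbTE fk).
apply: (cfunalgM S_alg); first by split; exact: smooth_on_coord.
apply: (cfunalg_real S_alg) => h; apply: Ck_onV; first exact: open_chart_open.
  by move=> z /(_ _ fk) zk; rewrite gt_eqF// sqrtr_gt0.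
apply: Ck_on_sqrt; first exact: open_chart_open.
  by move=> z; exact.
by apply: (funalg_rho S_alg) => h'; exact: smooth_on_coord.
Qed.

Lemma smooth_chart_inv :
  smooth_on [set y | interior_pts y.1] (chart_inv A b Lam w f e eps).
Proof.
have oI := @open_interior_fst 'rV[R]_(q + q).
have S_alg := smooth_on_funalg oI.
apply: smooth_on_mx => // i j.
apply: (funalg_ofC (F := fun k y => hat_pow (coordC y.2 (e k)) (eps k) *
  (((edge_scale A b Lam w f e k y.1)^-1)%:C)%C)) => k.
apply: (cfunalgM S_alg).
  by apply: (cfunalg_hat S_alg); split; exact: smooth_on_snd_coord.
apply: (cfunalg_real S_alg) => h; apply: Ck_onV => // [y yI|].
  by rewrite gt_eqF// edge_scale_gt0.
apply: (funalg_prod S_alg) => l fl; apply: (funalgX S_alg) => h'.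
apply: Ck_on_sqrt => // [y|]; first exact.
by apply: smooth_affine_pt => // h1 h2; exact: smooth_on_fst_coord.
Qed.

End ChartSmooth.

(** * The embedding *)

(** Combines the quotient topology of M with the topology induced on Z_P: the preimage of an open
    set is the trace of an open set of C^m. *)
Lemma open_quasitoricP (R : realType) n m (A : 'M[R]_(m, n)) b
    (Lam : 'M[int]_(n, m)) (D : set (quasitoric A b Lam)) :
  open D <-> exists2 B : set 'rV[R]_(m + m), open B &
    forall z : moment_angle A b, B (val z) <-> D (pi_l Lam z).
Proof.
split=> [[B oB BD]|[B oB BD]]; exists B => //.
  by move=> z; rewrite -[D _]/((pi_l Lam @^-1` D) z) -BD.
by apply/seteqP; split=> z /BD.
Qed.

(** * The algebra of real polynomial functions *)

Section RealPolynomials.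
Context {R : realType} {d : nat}.

Definition polyfun : set ('rV[R]_d -> R) :=
  [set F | exists P : mpoly.mpoly d R,
    forall z : 'rV[R]_d, F z = mpoly.meval (fun k => z 0 k) P].

Lemma polyfun_funalg : funalg polyfun.
Proof.
split=> [c|F G [P FP] [Q GQ]|F G [P FP] [Q GQ]].
- by exists (mpoly.mpolyC d c) => z; rewrite mpoly.mevalC.
- by eexists => z; rewrite /= FP GQ; exact: esym (mpoly.mevalD _ _ _).
- by eexists => z; rewrite /= FP GQ; exact: esym (mpoly.mevalM _ _ _).
Qed.

Lemma polyfun_coord i : polyfun (fun z : 'rV[R]_d => z 0 i).
Proof.
by exists (mpoly.mpolyX R (mpoly.mnm1 i)) => z; rewrite mpoly.mevalXU.
Qed.

Lemma real_polynomialP p q (g : 'rV[R]_d -> 'M[R]_(p, q)) :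
  (forall i j, polyfun (fun z => g z i j)) -> real_polynomial g.
Proof.
move=> gP; have /choice[P PP] (ij : 'I_p * 'I_q) : exists P : mpoly.mpoly d R,
    forall z, g z ij.1 ij.2 = mpoly.meval (fun k => z 0 k) P by exact: gP.
by exists (fun i j => P (i, j)) => z i j; exact: (PP (i, j)).
Qed.

End RealPolynomials.

Section Embedding.
Context {R : realType} {n m q : nat}.
Variables (A : 'M[R]_(m, n)) (b : 'cV[R]_m) (Lam : 'M[int]_(n, m)).
Variables (w : 'I_q -> 'rV[int]_n).

Local Notation M := (quasitoric A b Lam).

Definition edge_monomials (z : 'rV[R]_(m + m)) : 'rV[R]_(q + q) :=
  ofC (fun j => monomial (w j *m Lam) z).

Definition monomial_part (p : M) : 'rV[R]_(q + q) :=
  edge_monomials (val (repr p)).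

Definition embedding (p : M) := (moment_map p, monomial_part p).

(** The character is the pullback of [w j] along [torus_hom Lam], which sends K to 1. *)
Lemma character_ker (t : 'rV[R[i]]_m) j : torus_ker Lam t ->
  character t (w j *m Lam) = 1.
Proof.
move=> [t1 tL]; rewrite -character_torus_hom// tL /character big1// => i _.
by rewrite mxE exp1rz.
Qed.

Lemma monomial_part_pi (z : moment_angle A b) :
  monomial_part (pi_l Lam z) = edge_monomials (val z).
Proof.
rewrite /monomial_part; set p := pi_l Lam z.
have /pi_lP[t Kt ->] : pi_l Lam (repr p) = pi_l Lam z by exact: pi_l_repr.
congr ofC; apply/funext => j; rewrite monomial_torus_act; last by case: Kt.
by rewrite character_ker ?mul1r.
Qed.

Lemma embedding_pi (z : moment_angle A b) :
  embedding (pi_l Lam z) = (rho_P z, edge_monomials (val z)).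
Proof. by rewrite /embedding moment_mapE monomial_part_pi. Qed.

Lemma monomial_map_part : monomial_map monomial_part.
Proof.
exists (fun j => w j *m Lam) => [j t|z]; first exact: character_ker.
exact: monomial_part_pi.
Qed.

Lemma funalg_edge_monomials T (S : set (T -> R)) (F : T -> 'rV[R]_(m + m)) i j :
  funalg S -> (forall l, S (fun x => F x 0 l)) ->
  S (fun x => edge_monomials (F x) i j).
Proof.
move=> S_alg SF.
apply: (funalg_ofC (F := fun j x => monomial (w j *m Lam) (F x))) => l.
exact: cfunalg_monomial.
Qed.

Section AtVertex.
Variables (f : 'I_n -> 'I_m) (e : 'I_n -> 'I_q) (eps : 'I_n -> int).
Hypotheses (f_inj : injective f) (A_unit : rowsub f A \in unitmx).
Hypothesis Lam_unit : colsub f Lam \in unitmx.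
Hypothesis eps_sign : forall k, eps k = 1 \/ eps k = -1.
Hypothesis w_f : forall k l,
  (w (e k) *m Lam) 0 (f l) = if l == k then eps k else 0.

Local Notation chart_pt := (chart_pt A b f).
Local Notation chart_dom := (chart_dom A b f).
Local Notation chart_section := (chart_section A b f).
Local Notation chart := (@chart R n m A b Lam f).
Local Notation chart_inv := (chart_inv A b Lam w f e eps).
Local Notation interior_pts := (interior_pts A b f).

(** A single vertex suffices: the slacks at its facets are the sums of squares [rho z (f k) 0], and
    the point of P is affine in them on all of Z_P. *)
Lemma real_algebraic_embedding : real_algebraic embedding.
Proof.
exists (fun z => facet_inv A b f (rowsub f (rho z))), edge_monomials; split.
- apply: real_polynomialP => i j.
  apply: (funalg_facet_inv polyfun_funalg) => k l.
  rewrite (_ : (fun z => _) = fun z => rho z (f k) l).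
    by apply: (funalg_rho polyfun_funalg) => h; exact: polyfun_coord.
  by apply/funext => z; rewrite mxE.
- apply: real_polynomialP => i j; apply: funalg_edge_monomials polyfun_funalg _.
  exact: polyfun_coord.
- by move=> z; rewrite embedding_pi (rho_PE A_unit).
Qed.

Lemma embedding_chart p0 u : chart_dom u ->
  embedding (chart p0 u) = (chart_pt u, edge_monomials (chart_section u)).
Proof.
move=> domu; have [z [zu zx <-]] := chartP (Lam := Lam) f_inj A_unit p0 domu.
by rewrite embedding_pi zx zu.
Qed.

Lemma chart_inv_embedding p0 u : chart_dom u ->
  chart_inv (embedding (chart p0 u)) = u.
Proof. by move=> domu; rewrite embedding_chart// chart_invK. Qed.

(** The preimage is [chart_coord] of any representative, whose coordinates off the vertex are
    nonzero by the condition on the moment map. *)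
Lemma chart_surj p0 p : interior_pts (moment_map p) ->
  exists2 u, chart_dom u & chart p0 u = p.
Proof.
rewrite -[p]pi_l_repr moment_mapE => pI.
have zO : chart_open f (val (repr p)).
  by move=> i /pI; rewrite (rho_P_spec (repr p)).2.
have [domu <-] := chart_coordP f_inj A_unit Lam_unit p0 zO.
by exists (chart_coord Lam f (val (repr p))).
Qed.

Lemma chart_image p0 :
  chart p0 @` chart_dom = [set p | interior_pts (moment_map p)].
Proof.
apply/seteqP; split=> [p [u domu <-]|p /(chart_surj p0)[u domu <-]].
  by have /(congr1 fst) /= -> := embedding_chart p0 domu.
by exists u.
Qed.

Lemma smooth_embedding_chart p0 : smooth_on chart_dom (embedding \o chart p0).
Proof.
have oD := @open_chart_dom R n m A b f; have S_alg := smooth_on_funalg oD.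
move=> k; apply: (@Ck_on_eq _ _ _ _ _
    (fun u => (chart_pt u, edge_monomials (chart_section u)))) => //.
  by move=> u /set_mem domu /=; rewrite embedding_chart.
apply: smooth_on_pair => //; apply: smooth_on_mx => // i j.
  exact: smooth_chart_pt.
apply: (funalg_edge_monomials i j S_alg) => l h.
exact: smooth_chart_section_coord.
Qed.

Lemma smooth_chartP p0 : smooth_chart chart_dom (chart p0).
Proof.
split.
- exact: open_chart_dom.
- apply/open_quasitoricP; exists (chart_open f) => [|z].
    exact: open_chart_open.
  rewrite chart_image /= moment_mapE; split=> zO i /zO;
    by rewrite (rho_P_spec z).2.
- move=> u v domu domv uv.
  by rewrite -(chart_inv_embedding p0 domu) uv chart_inv_embedding.
- move=> u domu; exists chart_dom, chart_section; split=> //.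
  + exact: open_chart_dom.
  + exact: smooth_chart_section.
  + move=> v domv.
    by have [z [zv _ zp]] := chartP (Lam := Lam) f_inj A_unit p0 domv; exists z.
- move=> z zI; exists (chart_open f), (chart_coord Lam f); split.
  + exact: open_chart_open.
  + move: zI; rewrite chart_image /= moment_mapE => zI i /zI.
    by rewrite (rho_P_spec z).2.
  + exact: smooth_chart_coord.
  + by move=> z' z'O; exact: chart_coordP.
Qed.

(** Chain rule applied to the left inverse: [chart_inv \o F] is the identity near [u], so the
    differential of [chart_inv] inverts that of [F] on the left. *)
Lemma diff_embedding_inj p0 u : chart_dom u ->
  injective ('d (embedding \o chart p0) u).
Proof.
move=> domu; set F := embedding \o chart p0.
have oD := @open_chart_dom R n m A b f.
have dF : differentiable F u.
  by have [dF _] := smooth_embedding_chart p0 1; exact: dF.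
have dG : differentiable chart_inv (F u).
  have [dG _] := smooth_chart_inv A b Lam w f e eps 1; apply: dG.
  by rewrite (embedding_chart p0 domu : F u = _).
have GF : {near u, chart_inv \o F =1 id}.
  apply: filterS (open_nbhs_nbhs (conj oD domu)) => v domv.
  exact: chart_inv_embedding.
apply: (can_inj (g := 'd chart_inv (F u))) => v.
have := near_eq_derive v GF; rewrite derive_id => GFv; rewrite -[RHS]GFv.
by rewrite deriveE ?diff_comp//; exact: differentiable_comp.
Qed.

Lemma embedding_inj_at p p' : interior_pts (moment_map p) ->
  embedding p = embedding p' -> p = p'.
Proof.
(* The domain of the chart is a condition on the moment map alone, so [p'] lies in the same
   chart. *)
move=> pI pp'; have p'I : interior_pts (moment_map p') by case: pp' => <-.
have [u domu up] := chart_surj p pI; have [v domv vp'] := chart_surj p p'I.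
rewrite -up -vp' -(chart_inv_embedding p domu) up pp' -vp'.
by rewrite chart_inv_embedding.
Qed.

Lemma continuous_embedding : continuous embedding.
Proof.
apply/quotient_continuous.
(* The formula on Z_P makes sense on all of C^m, where it is smooth and hence continuous. *)
pose F (z : 'rV[R]_(m + m)) :=
  (facet_inv A b f (rowsub f (rho z)), edge_monomials z).
have -> : embedding \o \pi_(quasitoric A b Lam)%qT = F \o val.
  apply/funext => z /=; rewrite -[X in embedding X]/(pi_l Lam z).
  by rewrite embedding_pi (rho_PE A_unit).
have sF : smooth_on setT F.
  have S_alg := smooth_on_funalg (@openT 'rV[R]_(m + m)).
  apply: smooth_on_pair; [exact: openT| |].
    apply: smooth_on_mx => [|i j]; first exact: openT.
    apply: (funalg_facet_inv S_alg) => k l.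
    rewrite (_ : (fun z => _) = fun z => rho z (f k) l).
      by apply: (funalg_rho S_alg) => h; exact: smooth_on_coord.
    by apply/funext => z; rewrite mxE.
  apply: smooth_on_mx => [|i j]; first exact: openT.
  apply: (funalg_edge_monomials i j S_alg) => l; exact: smooth_on_coord.
move=> z; apply: continuous_comp; first exact: initial_continuous.
exact: (sF 0%N).
Qed.

(** [N] consists of the points over the chart whose image under [chart_inv] parametrizes a point of
    [D]. *)
Lemma embedding_open_at (D : set M) p : open D -> D p ->
  interior_pts (moment_map p) ->
  exists N, [/\ open N, N (embedding p) &
    range embedding `&` N `<=` embedding @` D].
Proof.
move=> /open_quasitoricP[B oB BD] Dp pI.
have oD := @open_chart_dom R n m A b f.
have oU := smooth_on_open_preimage oD (smooth_chart_section A b f) oB.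
have oN := smooth_on_open_preimage
  (@open_interior_fst R n m A b f 'rV[R]_(q + q))
  (smooth_chart_inv A b Lam w f e eps) oU.
have DE u : chart_dom u -> B (chart_section u) <-> D (chart p u).
  by move=> /(chartP (Lam := Lam) f_inj A_unit p)[z [<- _ <-]].
eexists; split; first exact: oN.
  have [u domu up] := chart_surj p pI.
  split=> //=; rewrite -up chart_inv_embedding//; split=> //=.
  by apply/DE => //; rewrite up.
(* An image point in [N] comes from the same chart, so [chart_inv] returns its true coordinate,
   which lies over [D]. *)
move=> y [[p' _ <-] [p'I /=]]; have [u domu <-] := chart_surj p p'I.
rewrite chart_inv_embedding// => -[_ /DE Du].
by exists (chart p u) => //; exact: Du.
Qed.

(** The right inverse of [Lam] is integral, hence induces a homomorphism of tori splitting
    [torus_hom Lam]. *)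
Lemma torus_hom_surj (t : 'rV[R[i]]_n) : torus t ->
  exists2 s : 'rV[R[i]]_m, torus s & torus_hom Lam s = t.
Proof.
move=> t1.
exists (torus_hom (colsub f 1%:M *m invmx (colsub f Lam)) t).
  exact: torus_torus_hom.
by rewrite torus_hom_comp// colsub_invmxK// torus_hom1.
Qed.

Lemma equivariant_embedding : equivariant (torus_hom (\matrix_j w j)) embedding.
Proof.
move=> t p t1; rewrite /quasitoric_act.
(* Any choice of [s] and [z] gives the same value under the embedding. The remaining case, an empty
   set of choices, is excluded by surjectivity of [torus_hom Lam]. *)
case: xgetP => [p' -> [s [z [z' [s1 sL <- z'z <-]]]]|].
  rewrite !embedding_pi /target_act /=; congr (_, _).
    by rewrite !(rho_PE A_unit) z'z rho_torus_act.
  congr ofC; apply/funext => j; rewrite z'z monomial_torus_act// ofCK.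
  by rewrite -character_torus_hom// sL mxE rowK.
have [s s1 sL] := torus_hom_surj t1.
have [z' z'z] := moment_angle_torus_act (repr p) s1.
move=> /(_ (pi_l Lam z')) []; exists s, (repr p), z'; split=> //.
exact: pi_l_repr.
Qed.

End AtVertex.
End Embedding.

Theorem theorem5p5 (R : realType) (n m : nat)
    (A : 'M[R]_(m, n)) (b : 'cV[R]_m) (Lam : 'M[int]_(n, m))
    (P_simple : simple_polytope A b) (Lam_indep : independence A b Lam)
    (q : nat) (w : 'I_q -> 'rV[int]_n)
    (w_inj : injective w) (w_range : range w = edge_vectors A b Lam) :
  exists phi : quasitoric A b Lam -> 'rV[R]_(q + q),
    let f := fun p => (moment_map p, phi p) in
    [/\ monomial_map phi, real_algebraic f, smooth_embedding f &
        equivariant (torus_hom (\matrix_j w j)) f].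
Proof.
have chart_at x := vertex_chart_data (x := x) P_simple Lam_indep w_range.
have moment_mapP (p : quasitoric A b Lam) : polyhedron A b (moment_map p).
  by rewrite -[p]pi_l_repr moment_mapE; exact: (rho_P_spec _).1.
(* One point of P provides one vertex, enough for the global claims: algebraicity, continuity and
   equivariance. *)
have [x0 Px0] : exists x, polyhedron A b x.
  by case: P_simple => _ [x [V [_ Px _ _]]] _ _; exists x.
have [f0 [_ [_ [_ A0 _ Lam0 _]]]] := chart_at _ Px0.
exists (monomial_part w); rewrite /= -/(embedding w); split.
- exact: monomial_map_part.
- exact: real_algebraic_embedding A0.
- split=> [p|]; last split.
  + have [f [e [eps [f_inj A_unit pI Lam_unit w_f]]]] :=
      chart_at _ (moment_mapP p).
    have eps_sign k := (w_f k).1; have wf k := (w_f k).2.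
    have [u domu up] := chart_surj f_inj A_unit Lam_unit p pI.
    exists (chart_dom A b f), (chart f p), u; split=> //.
    * exact: (smooth_chartP f_inj A_unit Lam_unit eps_sign wf).
    * exact: smooth_embedding_chart.
    * exact: (diff_embedding_inj f_inj A_unit eps_sign wf).
  + move=> p p'.
    have [f [e [eps [f_inj A_unit pI Lam_unit w_f]]]] :=
      chart_at _ (moment_mapP p).
    exact: (embedding_inj_at f_inj A_unit Lam_unit (fun k => (w_f k).1)
      (fun k => (w_f k).2)).
  + exact: continuous_embedding A0.
  + move=> D oD.
    pose F := @embedding R n m q A b Lam w; rewrite -/F.
    (* The vertex and its chart vary with the point of [D], so the open set is the union of all
       admissible neighbourhoods. *)
    pose good := [set N | open N /\ range F `&` N `<=` F @` D].
    exists (\bigcup_(N in good) N); first by apply: bigcup_open => N [].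
    apply/seteqP; split=> [_ [p Dp <-]|y [yr [N [_ Nsub] Ny]]]; last first.
      exact: Nsub.
    split; first by exists p.
    have [f [e [eps [f_inj A_unit pI Lam_unit w_f]]]] :=
      chart_at _ (moment_mapP p).
    have [N [oN Np Nsub]] := embedding_open_at f_inj A_unit Lam_unit
      (fun k => (w_f k).1) (fun k => (w_f k).2) oD Dp pI.
    by exists N.
- exact: equivariant_embedding A0 Lam0.
Qed.
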